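(* Let $\mathbf{x}_k,\mathbf{y}_k$ be generated by the 1P-DSGT algorithm described in the context with step sizes $\alpha_k=\alpha_0(k+1)^{-\upsilon_1}$ and $\gamma_k=\gamma_0(k+1)^{-\upsilon_2}$, where $\alpha_0,\gamma_0>0$, $0.5<\upsilon_1<1$ and $0<\upsilon_2\le1-\upsilon_1$. Suppose the Graph, Objective, Local-function, Noise, Perturbation and Strong-convexity assumptions stated in the context hold, and that there are finite constants $\bar M,G$ with $\mathbb{E}[\|\bar g_k\|^2]\le\bar M$ and $\|\mathbf{y}_k-\mathbf 1\bar y_k\|\le G$ (almost surely) for all $k$. Let $D_k=\mathbb{E}[\|\bar x_k-x^*\|^2]$ and $A=\lambda\alpha_2$. Let $K_0$ be the smallest $k$ with $A\alpha_k\gamma_k<1$, $K_1$ the smallest $k$ with $\big(\frac{1+\rho_w^2}{2}\big)^k\le\alpha_k^2$, and let $K_2\ge\max\{K_0,K_1\}$. If $$\alpha_0\gamma_0\ge\frac{\max\{2\upsilon_2,\upsilon_1-\upsilon_2\}}{A},$$ then there exists $\Upsilon<\infty$ such that $$D_k\le\Upsilon(k+1)^{-\min\{2\upsilon_2,\upsilon_1-\upsilon_2\}}\qquad\text{for all }k\ge K_2.$$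
   Context: Problem. $\mathcal N=\{1,\dots,n\}$ is a set of agents. Agent $i$ has a local function $f_i(x,S)\in\mathbb{R}$, $x\in\mathbb{R}^d$, where $S$ is an i.i.d. ergodic stochastic process with values in a set $\mathcal S\subseteq\mathbb{R}^m$. Put $F_i(x)=\mathbb{E}_S f_i(x,S)$ and $\mathcal F(x)=\frac1n\sum_{i=1}^n F_i(x)$; $x^*\in\mathbb{R}^d$ denotes the solution of $\min_{x\in\mathbb{R}^d}\mathcal F(x)$. $\|\cdot\|$ is the Euclidean norm for vectors and the Frobenius norm for matrices; $\|\cdot\|_2$ is the spectral norm; $\mathbf 1$ is the all-ones vector. Algorithm (1P-DSGT). Let $W=[w_{ij}]\in\mathbb{R}^{n\times n}$ be the agents' coupling matrix and $\alpha_k,\gamma_k>0$ step sizes. At time $k$, agent $i$ has $x_{i,k},y_{i,k}\in\mathbb{R}^d$ and the gradient estimate $$g_{i,k}=\Phi_{i,k}\big(f_i(x_{i,k}+\gamma_k\Phi_{i,k},S_{i,k})+\zeta_{i,k}\big),$$ where $\Phi_{i,k}\in\mathbb{R}^d$ is a perturbation generated randomly and independently by each agent, $S_{i,k}$ is the value of the stochastic process for agent $i$ at time $k$, and $\zeta_{i,k}$ is additive noise. Let $\mathbf{x}_k,\mathbf{y}_k,\mathbf{g}_k\in\mathbb{R}^{n\times d}$ be the matrices whose $i$-th rows are $x_{i,k}^T,y_{i,k}^T,g_{i,k}^T$. The initial $\mathbf{x}_0$ is arbitrary, $\mathbf{y}_0=\mathbf{g}_0$, and $$\mathbf{x}_{k+1}=W(\mathbf{x}_k-\alpha_k\mathbf{y}_k),\qquad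 \mathbf{y}_{k+1}=W\mathbf{y}_k+\mathbf{g}_{k+1}-\mathbf{g}_k .$$ The means are $\bar x_k=\frac1n\mathbf 1^T\mathbf{x}_k$, $\bar y_k=\frac1n\mathbf 1^T\mathbf{y}_k$, $\bar g_k=\frac1n\mathbf 1^T\mathbf{g}_k$ (in $\mathbb{R}^{1\times d}$). $\rho_w$ is the spectral norm of $W-\frac1n\mathbf 1\mathbf 1^T$ (under the Graph assumption $\rho_w<1$). Assumptions. - Graph: agents communicate over a connected undirected graph $(\mathcal N,\mathcal E)$; distinct agents $i,j$ are connected by an edge iff $w_{ij}=w_{ji}>0$, and $w_{ij}=w_{ji}=0$ otherwise; $W$ is nonnegative and doubly stochastic ($W\mathbf 1=\mathbf 1$, $\mathbf 1^TW=\mathbf 1^T$) and all $w_{ii}>0$. - Objective: $\nabla F_i$ and $\nabla^2F_i$ exist and are continuous; $\nabla F_i(x^* )=0$ and $\det(\nabla^2F_i(x^* ))>0$ for all $i$; $\mathcal F$ is strictly convex, with $\langle x-x^*,\nabla\mathcal F(x)\rangle\ge 0$ for all $x$; there is $\alpha_1>0$ with $\|\nabla^2F_i(x)\|_2\le\alpha_1$ for all $i$ and all $x$. - Local functions: $x\mapsto f_i(x,S)$ is Lipschitz with constant $L_S$ for every $i$, and $\mathbb{E}_Sf_i(x,S)<\infty$ for every $i$. - Noise: $\mathbb{E}(\zeta_{i,k})=0$, $\mathbb{E}(\zeta_{i,k}^2)=\alpha_4<\infty$ for all $i$, $\mathbb{E}(\zeta_{i,k}\zeta_{j,k})=0$ for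 $i\ne j$; $\zeta_{i,k}$ is a zero-mean uncorrelated noise. - Perturbation: $\Phi_{i,k}=(\phi_{i,k}^1,\dots,\phi_{i,k}^d)^T$ is chosen independently of the other agents; its entries are i.i.d. with $\mathbb{E}(\phi_{i,k}^{d_1}\phi_{i,k}^{d_2})=0$ for $d_1\ne d_2$ and $\mathbb{E}(\phi_{i,k}^{d_j})^2=\alpha_2>0$ for all $d_j$ and $i$; there is $\alpha_3>0$ with $\|\Phi_{i,k}\|\le\alpha_3$ for all $i$. - Strong convexity: there is $\lambda>0$ with $\langle\nabla\mathcal F(x),x-x^*\rangle\ge\lambda\|x-x^*\|^2$ for all $x\in\mathbb{R}^d$.
   Formalization: For d=1 the perturbation is additionally assumed to have mean zero (automatic for d≥2; without it the claim fails, e.g. for Φ=1), and the perturbations, the process values at distinct times and the additive noise are taken to be mutually independent. *)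

(* Defs.v *)
(* MathComp / MathComp-Analysis, over an arbitrary [R : realType]. *)
From HB Require Import structures.
From mathcomp Require Import all_boot all_order all_algebra.
From mathcomp Require Import all_classical all_reals all_analysis.
Set Implicit Arguments.
Unset Strict Implicit.
Unset Printing Implicit Defensive.
Import Order.TTheory GRing.Theory Num.Theory.
Import numFieldNormedType.Exports.
Local Open Scope classical_set_scope.
Local Open Scope ring_scope.

Section LinearAlgebra.
Context {R : realType}.

(* The norm [`|A|] that the library puts on ['M[R]_(p, q)] is the sup norm, so
   the Euclidean (vectors) / Frobenius (matrices) norm is introduced here. *)
Definition frob_norm p q (A : 'M[R]_(p, q)) : R :=
  Num.sqrt (\sum_(i < p) \sum_(j < q) A i j ^+ 2).

Definition dotv d (u v : 'rV[R]_d) : R := \sum_(j < d) u 0 j * v 0 j.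

Definition spectral_norm p q (A : 'M[R]_(p, q)) : R :=
  sup [set frob_norm (A *m v) | v in [set v : 'cV[R]_q | frob_norm v <= 1]].

Definition ones n : 'cV[R]_n := const_mx 1.

Definition row_mean n d (M : 'M[R]_(n, d)) : 'rV[R]_d :=
  n%:R^-1 *: ((ones n)^T *m M).

Definition consensus_error n d (M : 'M[R]_(n, d)) : 'M[R]_(n, d) :=
  M - ones n *m row_mean M.

Definition rho_w n (W : 'M[R]_n) : R :=
  spectral_norm (W - n%:R^-1 *: (ones n *m (ones n)^T)).

End LinearAlgebra.

Section Calculus.
Context {R : realType} {d : nat}.
Implicit Types F : 'rV[R]_d -> R.

Definition grad F (x : 'rV[R]_d) : 'rV[R]_d :=
  \row_(j < d) 'D_(delta_mx 0 j) F x.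

Definition hessian F (x : 'rV[R]_d) : 'M[R]_d := 'J (grad F) x.

Definition strictly_convex F : Prop :=
  forall (x y : 'rV[R]_d) (t : R), x != y -> 0 < t < 1 ->
    F (t *: x + (1 - t) *: y) < t * F x + (1 - t) * F y.

End Calculus.

Section Independence.
Context {disp : measure_display} {Omega : measurableType disp} {R : realType}.
Variable P : probability Omega R.

Definition sigma_of {disp' : measure_display} {T' : measurableType disp'}
    {I : Type} (X : I -> {RV P >-> T'}) : set (set Omega) :=
  <<s \bigcup_i preimage_set_system setT (X i) measurable >>.

Definition mutually_independent {I : eqType} (G : I -> set (set Omega)) : Prop :=
  forall (s : seq I) (E : I -> set Omega), uniq s ->
    (forall i, i \in s -> G i (E i)) ->
    fine (P (\bigcap_(i in [set` s]) E i)) = \prod_(i <- s) fine (P (E i)).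

Definition same_law {disp' : measure_display} {T' : measurableType disp'}
    (X Y : {RV P >-> T'}) : Prop :=
  forall B, measurable B -> distribution P X B = distribution P Y B.

End Independence.

Section Problem.
Context {R : realType} {n d m : nat}.
(* [R^m] is [m.-tuple R], which carries the product Borel sigma-algebra. *)
Variables (f : 'I_n -> 'rV[R]_d -> m.-tuple R -> R)
          (SS : set (m.-tuple R)) (muS : probability (m.-tuple R) R).

(* [muS] is the law of the process at one time, concentrated on [SS]. *)
Definition local_obj (i : 'I_n) (x : 'rV[R]_d) : R :=
  \int[muS]_(s in SS) f i x s.

Definition global_obj (x : 'rV[R]_d) : R :=
  n%:R^-1 * \sum_(i < n) local_obj i x.

Definition is_minimizer (xs : 'rV[R]_d) : Prop :=
  forall x, global_obj xs <= global_obj x.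

Record objective_assumption (xs : 'rV[R]_d) (alpha1 : R) : Prop := {
  obj_diff : forall i x, differentiable (local_obj i) x ;
  obj_grad_cont : forall i, continuous (grad (local_obj i)) ;
  obj_grad_diff : forall i x, differentiable (grad (local_obj i)) x ;
  obj_hess_cont : forall i, continuous (hessian (local_obj i)) ;
  obj_grad0 : forall i, grad (local_obj i) xs = 0 ;
  obj_det : forall i, 0 < \det (hessian (local_obj i) xs) ;
  obj_convex : strictly_convex global_obj ;
  obj_mono : forall x, 0 <= dotv (x - xs) (grad global_obj x) ;
  obj_alpha1 : 0 < alpha1 ;
  obj_hess_bound : forall i x, spectral_norm (hessian (local_obj i) x) <= alpha1
}.

Definition strong_convexity (xs : 'rV[R]_d) (lambda : R) : Prop :=
  0 < lambda /\
  forall x, lambda * frob_norm (x - xs) ^+ 2 <= dotv (grad global_obj x) (x - xs).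

(* The Lipschitz constant [L s] depends on the realization [s]: with one finite
   constant for all [s], the global objective would be Lipschitz, which is
   incompatible with strong convexity on the whole space. *)
Record local_function_assumption (L : m.-tuple R -> R) : Prop := {
  loc_meas : forall i x, measurable_fun SS (f i x) ;
  loc_lipschitz : forall i s, SS s -> forall x x',
    `|f i x s - f i x' s| <= L s * frob_norm (x - x') ;
  loc_integrable : forall i x, muS.-integrable SS (EFin \o f i x)
}.

End Problem.

(* [e] is the edge relation; only its values on distinct agents matter. *)
Record graph_assumption {R : realType} {n : nat} (e : rel 'I_n) (W : 'M[R]_n)
    : Prop := {
  graph_sym : symmetric e ;
  graph_connected : forall i j, connect e i j ;
  graph_edge : forall i j, i != j -> (e i j <-> W i j = W j i /\ 0 < W i j) ;
  graph_nonedge : forall i j, i != j -> ~~ e i j -> W i j = 0 /\ W j i = 0 ;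
  graph_nonneg : forall i j, 0 <= W i j ;
  graph_row_stoch : W *m ones n = ones n ;
  graph_col_stoch : (ones n)^T *m W = (ones n)^T ;
  graph_diag : forall i, 0 < W i i
}.

Section Randomness.
Context {disp : measure_display} {Omega : measurableType disp} {R : realType}.
Variable P : probability Omega R.
Context {n d m : nat}.
Variables (S : 'I_n -> nat -> {RV P >-> m.-tuple R})
          (phi : 'I_n -> nat -> 'I_d -> {RV P >-> R})
          (zeta : 'I_n -> nat -> {RV P >-> R}).

Definition perturbation (i : 'I_n) (k : nat) (w : Omega) : 'rV[R]_d :=
  \row_(j < d) phi i k j w.

Record process_assumption (SS : set (m.-tuple R))
    (muS : probability (m.-tuple R) R) : Prop := {
  proc_meas : measurable SS ;
  proc_values : forall i k w, SS (S i k w) ;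
  proc_law : forall i k B, measurable B -> distribution P (S i k) B = muS B
}.

Record noise_assumption (alpha4 : R) : Prop := {
  noise_mean : forall i k, ('E_P[zeta i k] = 0)%E ;
  noise_var : forall i k, ('E_P[fun w => (zeta i k w ^+ 2)%R] = alpha4%:E)%E ;
  noise_uncorr : forall i j k l, (i, k) != (j, l) ->
    ('E_P[fun w => (zeta i k w * zeta j l w)%R] = 0)%E
}.

(* For [d >= 2] the entries are centered because they are i.i.d. and pairwise
   orthogonal. For [d = 1] orthogonality is void, so centering is explicit. *)
Record perturbation_assumption (alpha2 alpha3 : R) : Prop := {
  pert_indep : forall i k,
    mutually_independent P (fun j => sigma_of (fun _ : unit => phi i k j)) ;
  pert_ident : forall i k j j', same_law (phi i k j) (phi i k j') ;
  pert_orth : forall i k j1 j2, j1 != j2 ->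
    ('E_P[fun w => (phi i k j1 w * phi i k j2 w)%R] = 0)%E ;
  pert_alpha2 : 0 < alpha2 ;
  pert_var : forall i k j, ('E_P[fun w => (phi i k j w ^+ 2)%R] = alpha2%:E)%E ;
  pert_alpha3 : 0 < alpha3 ;
  pert_bound : forall i k,
    {ae P, forall w, frob_norm (perturbation i k w) <= alpha3} ;
  pert_center1 : d = 1%N -> forall i k j, ('E_P[phi i k j] = 0)%E
}.

(* Mutually independent sources of randomness: one for each perturbation vector
   [Phi_(i,k)], one for the process at each time [k] (all agents together), and
   one for the whole additive noise. *)
Definition source := (('I_n * nat) + (nat + unit))%type.

Definition source_sigma (a : source) : set (set Omega) :=
  match a with
  | inl (i, k) => sigma_of (phi i k)
  | inr (inl k) => sigma_of (fun i => S i k)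
  | inr (inr _) => sigma_of (fun ik : 'I_n * nat => zeta ik.1 ik.2)
  end.

Definition independent_sources : Prop := mutually_independent P source_sigma.

Section Algorithm.
Variables (f : 'I_n -> 'rV[R]_d -> m.-tuple R -> R) (W : 'M[R]_n)
          (alpha gamma : nat -> R).

Definition grad_estimate (x : nat -> Omega -> 'M[R]_(n, d)) (k : nat)
    (w : Omega) : 'M[R]_(n, d) :=
  \matrix_(i < n, j < d)
    (perturbation i k w 0 j *
       (f i (row i (x k w) + gamma k *: perturbation i k w) (S i k w)
          + zeta i k w)).

Record is_1PDSGT (x0 : 'M[R]_(n, d)) (x y : nat -> Omega -> 'M[R]_(n, d))
    : Prop := {
  dsgt_x0 : forall w, x 0 w = x0 ;
  dsgt_y0 : forall w, y 0 w = grad_estimate x 0 w ;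
  dsgt_xS : forall k w, x k.+1 w = W *m (x k w - alpha k *: y k w) ;
  dsgt_yS : forall k w,
    y k.+1 w = W *m y k w + grad_estimate x k.+1 w - grad_estimate x k w
}.

End Algorithm.

End Randomness.

Definition is_smallest (Q : nat -> Prop) (k : nat) : Prop :=
  Q k /\ forall j, Q j -> (k <= j)%N.

Definition step {R : realType} (c u : R) (k : nat) : R := c * k.+1%:R `^ (- u).

(* Main.v *)
Require Import Defs.
From HB Require Import structures.
From mathcomp Require Import all_boot all_order all_algebra.
From mathcomp Require Import all_classical all_reals all_analysis.
From mathcomp Require Import measurable_realfun ring lra.
Set Implicit Arguments.
Unset Strict Implicit.
Unset Printing Implicit Defensive.
Import Order.TTheory GRing.Theory Num.Theory.
Import numFieldNormedType.Exports.
Local Open Scope classical_set_scope.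
Local Open Scope ring_scope.

(** Write [delta_k] for the mean iterate minus the minimizer and [D_k] for the
    mean of its squared norm.

    Averaging over the agents kills the mixing matrix: since [W] has unit column
    sums, the tracking variable has the mean of the gradient estimates
    ([row_mean_tracking]), so that [delta_(k+1) = delta_k - alpha_k gbar_k] and
    [D_(k+1) = D_k - 2 alpha_k E<delta_k, gbar_k> + alpha_k^2 E|gbar_k|^2].
    The last term is at most [alpha_k^2 Mbar]; everything rests on a lower bound
    for the inner product.

    The estimate at time [k] uses a fresh perturbation and a fresh value of the
    process, both independent of the past.  Averaging over the process replaces
    each [f_i] by its mean [F_i] ([mean_over_process]); averaging over the
    perturbation and expanding [F_i] to first order gives
    [gamma_k alpha2 <delta_k, grad F_i>] up to [O(gamma_k^2 |delta_k|)]
    ([perturbed_mean_ge], [mean_over_perturbation]).  The process is averaged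
    first because no bound on [f_i] locally uniform in [x] is assumed: the
    individual terms [f_i (x_(i,k) + gamma_k Phi, S)] need not be integrable,
    only their sum is, through [Mbar].  Fubini's theorem applied to the
    integrable sum ([decoupling]) leads, for a fixed past, to terms that are
    separately integrable.

    The gradients are taken at the agents' points rather than at their mean, and
    the error is Lipschitz in the consensus error.  On a connected graph with
    positive diagonal weights, [W] contracts the vectors of mean zero by a
    factor less than one ([mixing_contraction]); as the consensus error of the
    tracking variable is bounded by [G], that of [x_k] is [O(alpha_k)]
    ([consensus_bound], [geometric_rate]).  Strong convexity then yields, with
    [A = lambda alpha2],
    [D_(k+1) <= (1 - 3/2 A alpha_k gamma_k) D_k
                + O(alpha_k gamma_k (alpha_k^2 + gamma_k^2) + alpha_k^2)].
    Young's inequality can leave any rate below [2 A] in place of [3/2 A]; the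
    value [3/2 A] is strictly above [A], and this margin absorbs the decay of
    the target rate itself when [u1 + u2 = 1], by the lower bound on
    [alpha0 gamma0] ([rate_of_contraction], [stochastic_gradient_rate]).
    Finitely many initial steps only enlarge the constant, because every [D_k]
    is finite. *)

(** * Rates of convergence of real recursions *)

Section RateLemma.
Context {R : realType}.

(** Convexity of [t |-> t^(-v)]: the graph is above its tangent. *)
Lemma powR_shift_ge (v : R) (k : nat) : 0 <= v ->
  (1 - v / k.+1%:R) * k.+1%:R `^ (- v) <= k.+2%:R `^ (- v).
Proof.
move=> v0.
have k0 : 0 < k.+1%:R :> R by rewrite ltr0n.
have -> : k.+2%:R = k.+1%:R * (1 + k.+1%:R^-1) :> R.
  by rewrite mulrDr mulr1 divff ?gt_eqF// [in LHS]mulrS addrC.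
set q := k.+1%:R^-1; have q0 : 0 < q by rewrite invr_gt0.
have q1 : 0 < 1 + q by rewrite addr_gt0.
rewrite (powRM _ (ltW k0) (ltW q1)) [leLHS]mulrC ler_wpM2l ?powR_ge0//.
rewrite [leRHS]/powR gt_eqF//.
apply: le_trans (expR_ge1Dx _).
rewrite mulNr lerD2l lerN2 ler_wpM2l//.
by apply: le_ln1Dx; rewrite (lt_trans _ q0)// ltrN10.
Qed.

(** The bound [Y (k+1)^(-v)] is preserved by one step: the contraction gains
    [b_k Y], moving the bound from [k] to [k+1] costs at most [v/(k+1) Y], which
    is only a fraction [theta] of the gain, and [(1 - theta) Y >= C] pays for
    the perturbation. *)
Lemma rate_of_contraction (a b : nat -> R) (C v theta : R) (K : nat) :
  0 <= v -> 0 <= C -> theta < 1 ->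
  (forall k, (K <= k)%N ->
    [/\ 0 <= b k, b k <= 1, v / k.+1%:R <= theta * b k &
     a k.+1 <= (1 - b k) * a k + C * b k * k.+1%:R `^ (- v)]) ->
  exists2 Y, 0 <= Y & forall k, a k <= Y * k.+1%:R `^ (- v).
Proof.
move=> v0 C0 th1 rec.
have pw0 k : 0 < k.+1%:R `^ (- v) :> R by rewrite powR_gt0// ltr0n.
(* [Y] also dominates the first [K] terms, on which nothing is known. *)
pose q k := a k / k.+1%:R `^ (- v).
have [M M0 HM] : exists2 M, 0 <= M & forall k, (k <= K)%N -> q k <= M.
  exists (\sum_(k < K.+1) `|q k|); first by apply: sumr_ge0.
  move=> k kK; have kK' : (k < K.+1)%N by [].
  rewrite (bigD1 (Ordinal kK'))//= ler_wpDr//; first exact: sumr_ge0.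
  exact: ler_norm.
have Cth : 0 <= C / (1 - theta) by rewrite divr_ge0// subr_ge0 ltW.
set Y := M + C / (1 - theta); have Y0 : 0 <= Y by rewrite addr_ge0.
have aM k : (k <= K)%N -> a k <= Y * k.+1%:R `^ (- v).
  move=> /HM; rewrite /q ler_pdivrMr// => /le_trans; apply.
  by apply: ler_wpM2r; [exact: ltW|rewrite lerDl].
exists Y => // k; have [/aM//|/ltnW/subnK <-] := leqP k K.
elim: (k - K)%N => [|j IH]; first exact: aM.
have [bk0 bk1 bkv reck] := rec _ (leq_addl j K).
rewrite addSn; apply: le_trans reck _; move: IH bk0 bk1 bkv.
move: (j + K)%N => {}k IH bk0 bk1 bkv.
apply: le_trans (_ : Y * ((1 - v / k.+1%:R) * k.+1%:R `^ (- v)) <= _); last first.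
  by rewrite ler_wpM2l ?powR_shift_ge.
apply: le_trans
  (_ : (1 - b k) * (Y * k.+1%:R `^ (- v)) + C * b k * k.+1%:R `^ (- v) <= _).
  by rewrite lerD2r ler_wpM2l// subr_ge0.
rewrite 2!mulrA -mulrDl; apply: ler_wpM2r; first exact: ltW.
have Yth : C <= Y * (1 - theta).
  have t1 : 0 < 1 - theta by rewrite subr_gt0.
  by rewrite /Y mulrDl divfK ?gt_eqF// lerDr; apply: mulr_ge0; [|exact: ltW].
move: bkv; set w := v / _ => bkv.
have := ler_wpM2r bk0 Yth; have := ler_wpM2l Y0 bkv; lra.
Qed.

Lemma powRS_D (k : nat) (r s : R) :
  k.+1%:R `^ (r + s) = k.+1%:R `^ r * k.+1%:R `^ s :> R.
Proof. by rewrite powRD// pnatr_eq0 implybT. Qed.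

Lemma powRS_N_le (k : nat) (r s : R) : s <= r ->
  k.+1%:R `^ (- r) <= k.+1%:R `^ (- s) :> R.
Proof. by move=> sr; rewrite ler_powR ?ler1n// lerN2. Qed.

Lemma powRS_N_small (c s : R) : 0 <= c -> 0 < s ->
  exists K, forall k, (K <= k)%N -> c * k.+1%:R `^ (- s) <= 1.
Proof.
move=> c0 s0; exists (Num.bound (c `^ s^-1)) => k Kk.
have k0 : 0 < k.+1%:R `^ s by rewrite powR_gt0 ?ltr0n.
rewrite powRN ler_pdivrMr// mul1r.
have -> : c = (c `^ s^-1) `^ s by rewrite -powRrM mulVf ?gt_eqF// powRr1.
apply: ge0_ler_powR; rewrite ?nnegrE ?powR_ge0// ?(ltW s0)//.
apply: le_trans (ltW (archi_boundP (powR_ge0 _ _))) _.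
by rewrite ler_nat (leq_trans Kk).
Qed.

Lemma stepM (c c' u u' : R) k :
  step c u k * step c' u' k = c * c' * k.+1%:R `^ (- (u + u')).
Proof. by rewrite /step mulrACA -powRS_D -opprD. Qed.

Lemma step_ge0 (c u : R) k : 0 <= c -> 0 <= step c u k.
Proof. by move=> c0; rewrite mulr_ge0 ?powR_ge0. Qed.

(** A fixed contraction factor forgets the past so fast that the sequence
    inherits the decay of its forcing term. *)
Lemma geometric_rate (E : nat -> R) (q K c u : R) :
  0 <= q -> q < 1 -> 0 <= K -> 0 <= u ->
  (forall k, E k.+1 = q * E k + K * step c u k ^+ 2) ->
  exists2 Y, 0 <= Y & forall k, E k <= Y * k.+1%:R `^ (- (2 * u)).
Proof.
move=> q0 q1 K0 u0 rec; have q10 : 0 < 1 - q by rewrite subr_gt0.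
apply: (@rate_of_contraction E (fun=> 1 - q) (K * c ^+ 2 / (1 - q)) _ (1 / 2)
  (Num.bound (4 * u / (1 - q)))).
- by rewrite mulr_ge0.
- by rewrite divr_ge0 ?(ltW q10)// mulr_ge0 ?sqr_ge0.
- by lra.
move=> k Kk; split; [exact: ltW|by rewrite lerBlDr lerDl| |].
  rewrite ler_pdivrMr ?ltr0n//.
  have : 4 * u / (1 - q) <= k.+1%:R.
    apply: le_trans (ltW (archi_boundP _)) _.
      by rewrite divr_ge0 ?(ltW q10)// mulr_ge0.
    by rewrite ler_nat (leq_trans Kk).
  rewrite ler_pdivrMr// => h; lra.
by rewrite rec expr2 stepM subKr lerD2l divfK ?gt_eqF// mulrDl mul1r mulrA -expr2.
Qed.

(** Relative to the gain [alpha_k gamma_k], the three error terms are of orders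
    [alpha_k^2], [gamma_k^2] and [alpha_k / gamma_k]; the exponents of the last
    two give the two rates in the minimum, and the first is smaller than the
    third. *)
Lemma stochastic_gradient_rate (D E : nat -> R) (A C1 C2 M Y a0 g0 u1 u2 : R) :
  0 < A -> 0 < a0 -> 0 < g0 -> 1 / 2 < u1 -> 0 < u2 -> u2 <= 1 - u1 ->
  0 <= C1 -> 0 <= C2 -> 0 <= Y ->
  (forall k, E k <= Y * k.+1%:R `^ (- (2 * u1))) ->
  (forall k, D k.+1 <=
    (1 - 3 / 2 * A * (step a0 u1 k * step g0 u2 k)) * D k +
    step a0 u1 k * step g0 u2 k *
      (4 / A * (C1 * E k + C2 * step g0 u2 k ^+ 2)) +
    step a0 u1 k ^+ 2 * M) ->
  Num.max (2 * u2) (u1 - u2) / A <= a0 * g0 ->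
  exists2 Z, 0 <= Z & forall k,
    D k <= Z * k.+1%:R `^ (- Num.min (2 * u2) (u1 - u2)).
Proof.
move=> A0 a00 g00 u1h u20 u12 C10 C20 Y0 EY rec big_step.
set v := Num.min _ _.
have v2 : v <= 2 * u2 by rewrite /v ge_min lexx.
have v1 : v <= u1 - u2 by rewrite /v ge_min lexx orbT.
have v0 : 0 <= v by rewrite /v le_min; apply/andP; split; lra.
have vA : v <= A * (a0 * g0).
  rewrite mulrC -ler_pdivrMr//; apply: le_trans big_step.
  by rewrite ler_pM2r ?invr_gt0// le_max v2.
have ag0 : 0 < a0 * g0 by rewrite mulr_gt0.
pose b k := 3 / 2 * A * (step a0 u1 k * step g0 u2 k).
have b0 k : 0 <= b k.
  by rewrite mulr_ge0 ?mulr_ge0 ?step_ge0 ?(ltW A0) ?(ltW a00) ?(ltW g00)//; lra.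
have [K HK] := @powRS_N_small (3 / 2 * A * (a0 * g0)) (u1 + u2)
  ltac:(rewrite mulr_ge0 ?(ltW ag0)// mulr_ge0 ?(ltW A0)//; lra) ltac:(lra).
(* The coefficient of [b_k (k+1)^(-v)]: the error terms are proportional to
   [alpha_k gamma_k = b_k / (3/2 A)]. *)
pose C := (4 / A * (C1 * Y + C2 * g0 ^+ 2) + a0 / g0 * `|M|) / (3 / 2 * A).
(* [theta = 2/3] undoes the margin 3/2, leaving [v <= A alpha0 gamma0]. *)
apply: (@rate_of_contraction D b C v (2 / 3) K) => //.
- rewrite /C; apply: divr_ge0; last by rewrite mulr_ge0 ?(ltW A0)//; lra.
  apply: addr_ge0; last by rewrite mulr_ge0 ?divr_ge0 ?(ltW a00) ?(ltW g00).
  apply: mulr_ge0; first by rewrite divr_ge0 ?(ltW A0).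
  by apply: addr_ge0; apply: mulr_ge0; rewrite ?sqr_ge0.
- by lra.
move=> k Kk; set t := k.+1%:R `^ (- v).
have t0 : 0 <= t by rewrite powR_ge0.
split => //.
- by rewrite /b stepM mulrA HK.
- rewrite /b stepM.
  apply: (@le_trans _ _ (A * (a0 * g0) * k.+1%:R `^ (- 1))).
    by rewrite powR_inv1 ?ler0n// ler_wpM2r// invr_ge0.
  apply: (@le_trans _ _ (A * (a0 * g0) * k.+1%:R `^ (- (u1 + u2)))).
    by rewrite ler_wpM2l ?powRS_N_le//; [rewrite mulr_ge0 ?(ltW A0) ?(ltW ag0)|lra].
  by rewrite le_eqVlt; apply/orP; left; apply/eqP; field.
apply: le_trans (rec k) _; rewrite -/(b k) -addrA lerD2l.
have p0 : 0 <= step a0 u1 k * step g0 u2 k.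
  by rewrite mulr_ge0 ?step_ge0 ?(ltW a00) ?(ltW g00).
have E_t : E k <= Y * t by apply: le_trans (EY k) _; rewrite ler_wpM2l ?powRS_N_le//; lra.
have g_t : step g0 u2 k ^+ 2 <= g0 ^+ 2 * t.
  rewrite expr2 stepM -expr2 ler_wpM2l ?sqr_ge0// powRS_N_le//; lra.
have a_t : step a0 u1 k ^+ 2 * M <=
    step a0 u1 k * step g0 u2 k * (a0 / g0 * `|M| * t).
  have -> : step a0 u1 k ^+ 2 = step a0 u1 k * step g0 u2 k *
      (a0 / g0 * k.+1%:R `^ (- (u1 - u2))).
    rewrite expr2 (stepM a0 a0) (stepM a0 g0).
    rewrite (_ : - (u1 + u1) = - (u1 + u2) + - (u1 - u2)); last by ring.
    by rewrite powRS_D; field; rewrite gt_eqF.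
  rewrite -mulrA ler_wpM2l//.
  apply: (@le_trans _ _ (a0 / g0 * k.+1%:R `^ (- (u1 - u2)) * `|M|)).
    by rewrite ler_wpM2l ?ler_norm// mulr_ge0 ?powR_ge0// divr_ge0 ?(ltW a00) ?(ltW g00).
  rewrite -!mulrA ler_wpM2l ?(ltW a00)// ler_wpM2l ?invr_ge0 ?(ltW g00)//.
  by rewrite mulrC ler_wpM2l// powRS_N_le.
have inner : 4 / A * (C1 * E k + C2 * step g0 u2 k ^+ 2) <=
    4 / A * (C1 * Y + C2 * g0 ^+ 2) * t.
  rewrite -[leRHS]mulrA; apply: ler_wpM2l; first by rewrite divr_ge0 ?(ltW A0).
  rewrite mulrDl -(mulrA C1) -(mulrA C2).
  exact: lerD (ler_wpM2l C10 E_t) (ler_wpM2l C20 g_t).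
apply: le_trans (lerD (ler_wpM2l p0 inner) a_t) _.
rewrite le_eqVlt; apply/orP; left; apply/eqP; rewrite /C /b.
by field; rewrite !gt_eqF.
Qed.

End RateLemma.
(** * Euclidean, Frobenius and spectral norms *)

Section Euclidean.
Context {R : realType}.

Lemma frob_norm_ge0 p q (A : 'M[R]_(p, q)) : 0 <= frob_norm A.
Proof. exact: sqrtr_ge0. Qed.

Lemma sqr_frob_norm p q (A : 'M[R]_(p, q)) :
  frob_norm A ^+ 2 = \sum_i \sum_j A i j ^+ 2.
Proof.
by rewrite sqr_sqrtr// sumr_ge0// => i _; rewrite sumr_ge0// => j _; rewrite sqr_ge0.
Qed.

Lemma sqr_frob_norm_row d (u : 'rV[R]_d) : frob_norm u ^+ 2 = dotv u u.
Proof. by rewrite sqr_frob_norm big_ord1; apply: eq_bigr => j _; rewrite expr2. Qed.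

Lemma frob_norm_entry p q (A : 'M[R]_(p, q)) i j : `|A i j| <= frob_norm A.
Proof.
rewrite -(ler_pXn2r (isT : (0 < 2)%N)) ?nnegrE ?frob_norm_ge0//.
rewrite sqr_frob_norm real_normK ?num_real//.
rewrite (bigD1 i)//= (bigD1 j)//= -addrA lerDl addr_ge0//.
  by rewrite sumr_ge0// => l _; rewrite sqr_ge0.
by rewrite sumr_ge0// => l _; rewrite sumr_ge0// => l' _; rewrite sqr_ge0.
Qed.

Lemma frob_norm_row_le p q (A : 'M[R]_(p, q)) i :
  frob_norm (row i A) <= frob_norm A.
Proof.
rewrite -(ler_pXn2r (isT : (0 < 2)%N)) ?nnegrE ?frob_norm_ge0//.
rewrite !sqr_frob_norm big_ord1 (bigD1 i)//=.
under eq_bigr do rewrite mxE.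
by rewrite lerDl sumr_ge0// => l _; rewrite sumr_ge0// => l' _; rewrite sqr_ge0.
Qed.

Lemma frob_norm_trmx p q (A : 'M[R]_(p, q)) : frob_norm A^T = frob_norm A.
Proof.
rewrite /frob_norm exchange_big/=; congr Num.sqrt.
by apply: eq_bigr => i _; apply: eq_bigr => j _; rewrite mxE.
Qed.

Lemma frob_normZ p q (a : R) (A : 'M[R]_(p, q)) :
  frob_norm (a *: A) = `|a| * frob_norm A.
Proof.
apply: (pexpIrn (isT : (0 < 2)%N)); rewrite ?nnegrE ?mulr_ge0 ?frob_norm_ge0//.
rewrite exprMn !sqr_frob_norm real_normK ?num_real// mulr_sumr.
by apply: eq_bigr => i _; rewrite mulr_sumr; apply: eq_bigr => j _; rewrite mxE exprMn.
Qed.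

(** Young's inequality; it stands in for the triangle inequality and keeps all
    estimates quadratic. *)
Lemma sqr_frob_normB_le p q (A B : 'M[R]_(p, q)) (eta : R) : 0 < eta ->
  frob_norm (A - B) ^+ 2 <=
    (1 + eta) * frob_norm A ^+ 2 + (1 + eta^-1) * frob_norm B ^+ 2.
Proof.
move=> eta0; rewrite !sqr_frob_norm !mulr_sumr -big_split ler_sum// => i _.
rewrite !mulr_sumr -big_split ler_sum// => j _; rewrite !mxE /=.
move: (A i j) (B i j) => a b.
have : 0 <= eta^-1 * (eta * a + b) ^+ 2 by rewrite mulr_ge0 ?sqr_ge0// invr_ge0 ltW.
have -> : eta^-1 * (eta * a + b) ^+ 2 = eta * a ^+ 2 + 2 * a * b + eta^-1 * b ^+ 2.
  by field; rewrite gt_eqF.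
lra.
Qed.

Lemma dotvC d (u v : 'rV[R]_d) : dotv u v = dotv v u.
Proof. by apply: eq_bigr => j _; rewrite mulrC. Qed.

Lemma dotvDr d (u v w : 'rV[R]_d) : dotv u (v + w) = dotv u v + dotv u w.
Proof. by rewrite -big_split/=; apply: eq_bigr => j _; rewrite mxE mulrDr. Qed.

Lemma dotvZr d (u v : 'rV[R]_d) (a : R) : dotv u (a *: v) = a * dotv u v.
Proof. by rewrite mulr_sumr; apply: eq_bigr => j _; rewrite mxE mulrCA. Qed.

Lemma dotvBr d (u v w : 'rV[R]_d) : dotv u (v - w) = dotv u v - dotv u w.
Proof. by rewrite dotvDr -scaleN1r dotvZr mulN1r. Qed.

Lemma dotv_sumr d (I : finType) (u : 'rV[R]_d) (v : I -> 'rV[R]_d) :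
  dotv u (\sum_i v i) = \sum_i dotv u (v i).
Proof.
rewrite exchange_big/=; apply: eq_bigr => j _.
by rewrite summxE mulr_sumr.
Qed.

Lemma sqr_dotv_le d (u v : 'rV[R]_d) : dotv u v ^+ 2 <= dotv u u * dotv v v.
Proof.
have [v0|vn0] := eqVneq (dotv v v) 0.
  have vj j : v 0 j = 0.
    apply/eqP; rewrite -sqrf_eq0 expr2; move: v0 => /eqP.
    rewrite psumr_eq0 => [/allP/(_ j)|l _]; last by rewrite -expr2 sqr_ge0.
    by rewrite mem_index_enum => /(_ isT).
  by rewrite v0 /dotv big1 ?expr0n ?mulr0// => j _; rewrite vj mulr0.
have vv0 : 0 < dotv v v.
  by rewrite lt_neqAle eq_sym vn0 -sqr_frob_norm_row sqr_ge0.
(* This vector is [|v|^2] times the component of [u] orthogonal to [v]. *)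
have : 0 <= dotv (dotv v v *: u - dotv u v *: v) (dotv v v *: u - dotv u v *: v).
  by rewrite -sqr_frob_norm_row sqr_ge0.
rewrite dotvBr !dotvZr 2![dotv (_ - _) _]dotvC !dotvBr !dotvZr (dotvC v u) => h.
rewrite -(ler_pM2l vv0) -subr_ge0; apply: le_trans h _.
by rewrite le_eqVlt; apply/orP; left; apply/eqP; ring.
Qed.

Lemma CauchySchwarz_dotv d (u v : 'rV[R]_d) :
  `|dotv u v| <= frob_norm u * frob_norm v.
Proof.
rewrite -(ler_pXn2r (isT : (0 < 2)%N)) ?nnegrE ?mulr_ge0 ?frob_norm_ge0//.
rewrite real_normK ?num_real// exprMn !sqr_frob_norm_row.
exact: sqr_dotv_le.
Qed.

Lemma frob_norm_mulmx_le p q (A : 'M[R]_(p, q)) (v : 'cV[R]_q) :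
  frob_norm (A *m v) <= frob_norm A * frob_norm v.
Proof.
rewrite -(ler_pXn2r (isT : (0 < 2)%N)) ?nnegrE ?mulr_ge0 ?frob_norm_ge0//.
rewrite exprMn !(sqr_frob_norm (_ *m _)) (sqr_frob_norm A) mulr_suml ler_sum// => i _.
rewrite big_ord1.
have := sqr_dotv_le (row i A) v^T; rewrite -!sqr_frob_norm_row frob_norm_trmx.
rewrite (sqr_frob_norm (row _ _)) big_ord1 /dotv mxE.
under eq_bigr do rewrite !mxE.
by under [X in _ <= X * _]eq_bigr do rewrite !mxE.
Qed.

Lemma spectral_norm_mulmx_le p q (A : 'M[R]_(p, q)) (v : 'cV[R]_q) :
  frob_norm (A *m v) <= spectral_norm A * frob_norm v.
Proof.
have ub : has_ubound [set frob_norm (A *m v) | v in [set v : 'cV[R]_q | frob_norm v <= 1]].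
  exists (frob_norm A) => _ [u /= u1 <-].
  by apply: le_trans (frob_norm_mulmx_le _ _) _; rewrite ler_piMr// frob_norm_ge0.
have [v0|v0] := eqVneq (frob_norm v) 0.
  by apply: le_trans (frob_norm_mulmx_le _ _) _; rewrite v0 !mulr0.
have vgt0 : 0 < frob_norm v by rewrite lt_neqAle eq_sym v0 frob_norm_ge0.
rewrite -ler_pdivrMr// mulrC -[_^-1]ger0_norm ?invr_ge0 ?frob_norm_ge0//.
rewrite -frob_normZ scalemxAr.
apply: ub_le_sup => //; exists ((frob_norm v)^-1 *: v) => //=.
by rewrite frob_normZ ger0_norm ?invr_ge0 ?frob_norm_ge0// mulVf.
Qed.

(** The spectral norm is defined by the action on columns, while a differential
    acts on rows; in the bilinear form the second vector can be made the column
    on which [A] acts. *)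
Lemma bilinear_spectral_norm_le d (A : 'M[R]_d) (u v : 'rV[R]_d) :
  `|dotv (u *m A) v| <= spectral_norm A * (frob_norm u * frob_norm v).
Proof.
have -> : dotv (u *m A) v = dotv u (A *m v^T)^T.
  transitivity ((u *m A *m v^T) 0 0).
    by rewrite [RHS]mxE; apply: eq_bigr => j _; rewrite [v^T _ _]mxE.
  by rewrite -mulmxA [LHS]mxE; apply: eq_bigr => j _; rewrite [_^T _ _]mxE.
apply: le_trans (CauchySchwarz_dotv _ _) _.
rewrite frob_norm_trmx mulrCA ler_wpM2l ?frob_norm_ge0//.
by apply: le_trans (spectral_norm_mulmx_le _ _) _; rewrite frob_norm_trmx.
Qed.

End Euclidean.
(** * Contraction of the mixing matrix on vectors of mean zero *)

Section Mixing.
Context {R : realType} {n : nat}.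

(** Jensen's inequality for the square with a quantitative defect: the variance
    of [v] under the weights [p] is at least what the two points [a] and [b]
    alone contribute to it. *)
Lemma variance_ge_edge (p v : 'I_n -> R) (a b : 'I_n) :
  (forall j, 0 <= p j) -> \sum_j p j = 1 ->
  (\sum_j p j * v j) ^+ 2 + p a * p b * (v a - v b) ^+ 2 <= \sum_j p j * v j ^+ 2.
Proof.
move=> p0 p1; set m := \sum_j p j * v j.
have E : \sum_j p j * (v j - m) ^+ 2 = \sum_j p j * v j ^+ 2 - m ^+ 2.
  transitivity (\sum_j (p j * v j ^+ 2 - 2 * m * (p j * v j) + m ^+ 2 * p j)).
    by apply: eq_bigr => j _; ring.
  by rewrite big_split/= sumrB -!mulr_sumr -/m p1; ring.
have [->|ab] := eqVneq a b.
  rewrite subrr expr0n mulr0 addr0 -subr_ge0 -E.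
  by apply: sumr_ge0 => j _; rewrite mulr_ge0 ?sqr_ge0.
rewrite addrC -lerBrDr -E (bigD1 a)//= (bigD1 b) 1?eq_sym//= addrA.
rewrite -[leLHS]addr0 lerD//; last first.
  by apply: sumr_ge0 => j _; rewrite mulr_ge0 ?sqr_ge0.
have : p a + p b <= 1.
  rewrite -p1 (bigD1 a)//= (bigD1 b) 1?eq_sym//= addrA lerDl.
  by apply: sumr_ge0.
have -> : v a - v b = (v a - m) - (v b - m) by ring.
move: (v a - m) (v b - m) (p0 a) (p0 b) => x y.
move: (p a) (p b) => s t s0 t0 st.
have h1 : 0 <= (s * x + t * y) ^+ 2 by rewrite sqr_ge0.
have h2 : 0 <= s * (1 - s - t) * x ^+ 2 by apply: mulr_ge0 (sqr_ge0 _); apply: mulr_ge0 => //; lra.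
have h3 : 0 <= t * (1 - s - t) * y ^+ 2 by apply: mulr_ge0 (sqr_ge0 _); apply: mulr_ge0 => //; lra.
by nra.
Qed.

Lemma path_variation (e : rel 'I_n) (v : 'I_n -> R) (D : R) (i j : 'I_n) :
  0 <= D -> (forall a b, e a b -> `|v a - v b| <= D) ->
  connect e i j -> `|v i - v j| <= n%:R * D.
Proof.
move=> D0 vD /connectP[p0 ep0 ->].
case: (shortenP ep0) => p ep up _.
apply: (@le_trans _ _ ((size p)%:R * D)); last first.
  rewrite ler_wpM2r// ler_nat.
  have := max_card (mem (i :: p)); rewrite card_ord (card_uniqP up) => /ltnW.
  exact.
elim: p i ep {up ep0} => [|a p IH] i /=; first by rewrite subrr normr0 mul0r.
move=> /andP[eia /IH h].
rewrite -(subrKA (v a)) (le_trans (ler_normD _ _))//.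
by rewrite mulrS mulrDl mul1r lerD// vD.
Qed.

Lemma stochastic_rows (W : 'M[R]_n) :
  W *m ones n = ones n -> forall i, \sum_j W i j = 1.
Proof.
move=> /matrixP h i; have := h i 0; rewrite !mxE => <-.
by apply: eq_bigr => j _; rewrite mxE mulr1.
Qed.

Lemma stochastic_cols (W : 'M[R]_n) :
  (ones n)^T *m W = (ones n)^T -> forall j, \sum_i W i j = 1.
Proof.
move=> /matrixP h j; have := h 0 j; rewrite !mxE => <-.
by apply: eq_bigr => i _; rewrite !mxE mul1r.
Qed.

(** The defect [|v|^2 - |W v|^2] is a sum over the rows of [W] of variances of
    [v].  Row [a] sees both [a], as the diagonal is positive, and every
    neighbour [b] of [a], so a small defect forces [v] to vary little along each
    edge, hence, by connectedness, over the whole graph; a vector of mean zero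
    which is nearly constant is small. *)
Lemma mixing_contraction_fun (e : rel 'I_n) (W : 'M[R]_n) :
  (0 < n)%N -> graph_assumption e W ->
  exists r : R, [/\ 0 <= r, r < 1 & forall v : 'I_n -> R, \sum_i v i = 0 ->
    \sum_i (\sum_j W i j * v j) ^+ 2 <= r * \sum_i v i ^+ 2].
Proof.
move=> n0 gW; have W0 := graph_nonneg gW.
have rows := stochastic_rows (graph_row_stoch gW).
have cols := stochastic_cols (graph_col_stoch gW).
have Wdiag := graph_diag gW.
have edge_gt0 a b : e a b -> 0 < W a a * W a b.
  move=> eab; rewrite mulr_gt0//; have [<-//|ab] := eqVneq a b.
  by have [/(_ eab)[]] := graph_edge gW ab.
pose c := \big[Num.min/1]_(ab : 'I_n * 'I_n | e ab.1 ab.2)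
  (W ab.1 ab.1 * W ab.1 ab.2).
have c0 : 0 < c.
  rewrite /c; elim/big_ind: _ => // [x z x0 z0|ab]; last exact: edge_gt0.
  by rewrite lt_min x0.
have c1 : c <= 1 by exact: bigmin_le_id.
have cW a b : e a b -> c <= W a a * W a b.
  by move=> eab; apply: (@bigmin_le_cond _ _ _ _ (a, b)).
have nR : 1 <= n%:R :> R by rewrite ler1n.
have nR0 : 0 < n%:R :> R by rewrite ltr0n.
have n31 : 1 <= n%:R ^+ 3 :> R by rewrite exprn_ege1.
have n30 : 0 < n%:R ^+ 3 :> R by apply: lt_le_trans n31.
(* Powers of [n]: two from the squared length of a path, one from summing the
   squares of the entries of [v]. *)
exists (1 - c / n%:R ^+ 3); split.
- by rewrite subr_ge0 ler_pdivrMr// mul1r (le_trans c1).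
- by rewrite ltrBlDr ltrDl divr_gt0.
move=> v v0.
pose gap := \sum_i v i ^+ 2 - \sum_i (\sum_j W i j * v j) ^+ 2.
have gapE : gap = \sum_i (\sum_j W i j * v j ^+ 2 - (\sum_j W i j * v j) ^+ 2).
  rewrite sumrB exchange_big/=; congr (_ - _).
  by apply: eq_bigr => i _; rewrite -mulr_suml cols mul1r.
have term0 i a b : W i a * W i b * (v a - v b) ^+ 2 <=
    \sum_j W i j * v j ^+ 2 - (\sum_j W i j * v j) ^+ 2.
  by rewrite lerBrDl variance_ge_edge.
have gap_term i : \sum_j W i j * v j ^+ 2 - (\sum_j W i j * v j) ^+ 2 <= gap.
  rewrite gapE [leRHS](bigD1 i)//= lerDl sumr_ge0// => l _.
  by apply: le_trans (term0 l i i); rewrite subrr expr0n mulr0.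
have gap0 : 0 <= gap.
  apply: le_trans (gap_term (Ordinal n0)).
  by apply: le_trans (term0 _ (Ordinal n0) (Ordinal n0)); rewrite subrr expr0n mulr0.
pose D := Num.sqrt (gap / c).
have gc0 : 0 <= gap / c by rewrite divr_ge0// ltW.
have D0 : 0 <= D by exact: sqrtr_ge0.
have DE : D ^+ 2 = gap / c by rewrite sqr_sqrtr.
have vD a b : e a b -> `|v a - v b| <= D.
  move=> eab; rewrite -(ler_pXn2r (isT : (0 < 2)%N)) ?nnegrE//.
  rewrite real_normK ?num_real// DE ler_pdivlMr//.
  apply: le_trans (le_trans (term0 a a b) (gap_term a)).
  by rewrite mulrC ler_wpM2r ?sqr_ge0// cW.
have vi i : v i ^+ 2 <= n%:R ^+ 2 * (gap / c).
  rewrite -DE -exprMn -real_normK ?num_real//.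
  rewrite ler_pXn2r ?nnegrE ?mulr_ge0 ?(ltW nR0)//.
  have : n%:R * v i = \sum_j (v i - v j).
    by rewrite sumrB v0 subr0 sumr_const card_ord mulr_natl.
  move=> /(congr1 Num.norm); rewrite normrM ger0_norm ?(ltW nR0)// => h.
  rewrite -(ler_pM2l nR0) h (le_trans (ler_norm_sum _ _ _))//.
  apply: (@le_trans _ _ (\sum_(j < n) (n%:R * D))).
    by apply: ler_sum => j _; apply: path_variation vD (graph_connected gW i j).
  by rewrite sumr_const card_ord -[leLHS]mulr_natl.
have : \sum_i v i ^+ 2 <= n%:R ^+ 3 * (gap / c).
  apply: (@le_trans _ _ (\sum_(j < n) (n%:R ^+ 2 * (gap / c)))).
    by apply: ler_sum => i _.
  by rewrite sumr_const card_ord -[leLHS]mulr_natl mulrA -exprS.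
move=> h.
have : c / n%:R ^+ 3 * \sum_i v i ^+ 2 <= gap.
  apply: le_trans (_ : c / n%:R ^+ 3 * (n%:R ^+ 3 * (gap / c)) <= _).
    by rewrite ler_wpM2l// divr_ge0// ltW.
  by rewrite le_eqVlt; apply/orP; left; apply/eqP; field; rewrite !gt_eqF.
rewrite /gap; lra.
Qed.

Lemma mixing_contraction d (e : rel 'I_n) (W : 'M[R]_n) :
  (0 < n)%N -> graph_assumption e W ->
  exists r : R, [/\ 0 <= r, r < 1 & forall M : 'M[R]_(n, d), row_mean M = 0 ->
    frob_norm (W *m M) ^+ 2 <= r * frob_norm M ^+ 2].
Proof.
move=> n0 gW; have [r [r0 r1 rP]] := mixing_contraction_fun n0 gW.
exists r; split => // M M0; rewrite !sqr_frob_norm exchange_big/= [in leRHS]exchange_big/=.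
rewrite mulr_sumr; apply: ler_sum => j _.
under eq_bigr do rewrite mxE; apply: rP.
move/eqP: M0; rewrite scaler_eq0 invr_eq0 pnatr_eq0 -leqn0 leqNgt n0/=.
move=> /eqP/matrixP/(_ 0 j); rewrite !mxE => h; rewrite -[RHS]h.
by apply: eq_bigr => i _; rewrite !mxE mul1r.
Qed.

End Mixing.
(** * Gradients along segments and first-order expansion *)

Section Taylor.
Context {R : realType} {d : nat}.
Implicit Types (F : 'rV[R]_d -> R) (x h u : 'rV[R]_d).

Lemma is_derive_line (V : normedModType R) (f : 'rV[R]_d -> V) x h (t : R) :
  differentiable f (x + t *: h) ->
  is_derive t 1 (fun s : R => f (x + s *: h)) ('D_h f (x + t *: h)).
Proof.
move=> df; have {df} : derivable f (x + t *: h) h by apply: diff_derivable.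
have E : (fun k : R => k^-1 *:
    (((fun s : R => f (x + s *: h)) \o shift t) (k *: (1 : R)) - f (x + t *: h)))
  = (fun k : R => k^-1 *: ((f \o shift (x + t *: h)) (k *: h) - f (x + t *: h))).
  apply/funext => k /=; congr (_ *: (f _ - _)).
  by rewrite [k%:A]mulr1 scalerDl addrCA.
by move=> df; apply: DeriveDef; rewrite /derivable /derive E.
Qed.

Lemma dotv_grad F x h : differentiable F x -> dotv h (grad F x) = 'D_h F x.
Proof.
move=> dF; rewrite deriveE// [in RHS](row_sum_delta h) linear_sum/=.
by apply: eq_bigr => j _; rewrite linearZ mxE deriveE.
Qed.

Lemma continuous_line (V : normedModType R) (f : 'rV[R]_d -> V) x h :
  (forall y, differentiable f y) -> continuous (fun s : R => f (x + s *: h)).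
Proof.
move=> df t; apply: differentiable_continuous; apply/derivable1_diffP.
by have [] := is_derive_line (df (x + t *: h)).
Qed.

Lemma mean_value F x h : (forall y, differentiable F y) ->
  exists2 t : R, 0 <= t <= 1 & F (x + h) - F x = dotv h (grad F (x + t *: h)).
Proof.
move=> dF.
have [t t01] := @MVT R (fun s : R => F (x + s *: h)) (fun s => 'D_h F (x + s *: h)) 0 1 ltr01
  (fun t _ => is_derive_line (dF _)) (continuous_subspaceT (continuous_line dF)).
rewrite scale1r scale0r addr0 subr0 mulr1 => ->.
exists t; last by rewrite dotv_grad.
by move: t01; rewrite in_itv/= => /andP[/ltW-> /ltW->].
Qed.

(** Testing the gradient against a fixed [u] reduces the claim to the mean value
    theorem for a real function, whose derivative is a value of the bilinear
    form of the Hessian. *)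
Lemma grad_Lipschitz F (C : R) x h u :
  (forall y, differentiable (grad F) y) ->
  (forall y, spectral_norm (hessian F y) <= C) ->
  `|dotv u (grad F (x + h) - grad F x)| <= C * (frob_norm h * frob_norm u).
Proof.
move=> dG HC.
pose phi (s : R) := dotv u (grad F (x + s *: h)).
have dphi (t : R) : is_derive t 1 phi (dotv u ('D_h (grad F) (x + t *: h))).
  have -> : phi = \sum_(j < d) (fun s => u 0 j *: (grad F (x + s *: h)) 0 j).
    by apply/funext => s; rewrite fct_sumE.
  apply: is_derive_sum => j; apply: is_deriveZ.
  have [dl <-] := is_derive_line (dG (x + t *: h)).
  split; first by have /derivable_mxP := dl; apply.
  by rewrite [in RHS]derive_mx// mxE.
have cphi : continuous phi.
  by move=> t; apply: differentiable_continuous; apply/derivable1_diffP; case: (dphi t).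
have [t t01] := @MVT R phi _ 0 1 ltr01 (fun t _ => dphi t) (continuous_subspaceT cphi).
rewrite /phi scale1r scale0r addr0 subr0 mulr1 -dotvBr => ->.
rewrite deriveEjacobian// dotvC.
apply: le_trans (bilinear_spectral_norm_le _ _ _) _.
by apply: ler_wpM2r; [rewrite mulr_ge0// frob_norm_ge0|exact: HC].
Qed.

(** The mean value theorem gives a bound twice the sharp one, with gradients
    only. *)
Lemma Taylor1 F (C : R) x h :
  (forall y, differentiable F y) ->
  (forall y, differentiable (grad F) y) ->
  (forall y, spectral_norm (hessian F y) <= C) ->
  `|F (x + h) - F x - dotv h (grad F x)| <= C * frob_norm h ^+ 2.
Proof.
move=> dF dG HC; have [t /andP[t0 t1] ->] := mean_value x h dF.
rewrite -dotvBr; apply: le_trans (grad_Lipschitz _ _ _ dG HC) _.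
rewrite frob_normZ ger0_norm// -mulrA -expr2 mulrCA ler_piMl//.
have := grad_Lipschitz x h h dG HC.
by move=> /(le_trans (normr_ge0 _)); rewrite -expr2.
Qed.

Lemma grad_mean (n : nat) (F : 'I_n -> 'rV[R]_d -> R) x :
  (forall i, differentiable (F i) x) ->
  grad (fun y => n%:R^-1 * \sum_i F i y) x = n%:R^-1 *: \sum_i grad (F i) x.
Proof.
move=> dF; apply/rowP => j; rewrite !mxE summxE.
have -> : (fun y => n%:R^-1 * \sum_i F i y) = n%:R^-1 \*: (\sum_(i < n) F i).
  by apply/funext => y /=; rewrite fct_sumE.
have dv i : derivable (F i) x (delta_mx 0 j) by exact: diff_derivable.
rewrite deriveZ/=; last exact: derivable_sum.
by rewrite derive_sum//; congr (_ * _); apply: eq_bigr => i _; rewrite mxE.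
Qed.

End Taylor.
(** * Measurability *)

Section MeasurableMatrix.
Context {R : realType} {disp : measure_display} {T : measurableType disp}.

(** Random matrices are measured entrywise, which is the Borel structure without
    having to put one on the type of matrices. *)
Definition measurable_mx p q (Y : T -> 'M[R]_(p, q)) : Prop :=
  forall i j, measurable_fun setT (fun t => Y t i j).

Lemma measurable_mx_cst p q (A : 'M[R]_(p, q)) : measurable_mx (fun=> A).
Proof. by move=> i j; exact: measurable_cst. Qed.

Lemma measurable_mxD p q (Y Z : T -> 'M[R]_(p, q)) :
  measurable_mx Y -> measurable_mx Z -> measurable_mx (fun t => Y t + Z t).
Proof.
by move=> mY mZ i j; under eq_fun do rewrite mxE; exact: measurable_funD.
Qed.

Lemma measurable_mxZ p q (a : R) (Y : T -> 'M[R]_(p, q)) :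
  measurable_mx Y -> measurable_mx (fun t => a *: Y t).
Proof.
by move=> mY i j; under eq_fun do rewrite mxE; exact: measurable_funM.
Qed.

Lemma measurable_mxB p q (Y Z : T -> 'M[R]_(p, q)) :
  measurable_mx Y -> measurable_mx Z -> measurable_mx (fun t => Y t - Z t).
Proof.
move=> mY mZ; under eq_fun do rewrite -[- Z _]scaleN1r.
exact/measurable_mxD/measurable_mxZ.
Qed.

Lemma measurable_mxM p q r (A : 'M[R]_(p, q)) (Y : T -> 'M[R]_(q, r)) :
  measurable_mx Y -> measurable_mx (fun t => A *m Y t).
Proof.
move=> mY i j; under eq_fun do rewrite mxE.
by apply: measurable_sum => l; exact: measurable_funM.
Qed.

Lemma measurable_mx_row p q (Y : T -> 'M[R]_(p, q)) i :
  measurable_mx Y -> measurable_mx (fun t => row i (Y t)).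
Proof. by move=> mY i' j; under eq_fun do rewrite mxE; exact: mY. Qed.

Lemma measurable_mx_mean p q (Y : T -> 'M[R]_(p, q)) :
  measurable_mx Y -> measurable_mx (fun t => row_mean (Y t)).
Proof. by move=> mY; exact/measurable_mxZ/measurable_mxM. Qed.

Lemma measurable_mx_dotv q (Y Z : T -> 'rV[R]_q) :
  measurable_mx Y -> measurable_mx Z ->
  measurable_fun setT (fun t => dotv (Y t) (Z t)).
Proof.
by move=> mY mZ; apply: measurable_sum => j; exact: measurable_funM.
Qed.

End MeasurableMatrix.

Lemma measurable_mx_comp (R : realType) (disp disp' : measure_display)
  (T : measurableType disp) (T' : measurableType disp') (g : T' -> T) p q
  (Y : T -> 'M[R]_(p, q)) : measurable_fun setT g -> measurable_mx Y ->
  measurable_mx (fun t => Y (g t)).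
Proof. by move=> mg mY i j; exact: (measurableT_comp (mY i j) mg). Qed.

Section Caratheodory.
Context {R : realType} {d : nat}.

Lemma measurable_fun_countable_param (disp disp' : measure_display)
  (T : measurableType disp) (U : measurableType disp') (I : countType)
  (Z : T -> I) (h : I -> T -> U) :
  (forall z, measurable [set t | Z t = z]) ->
  (forall z, measurable_fun setT (h z)) ->
  measurable_fun setT (fun t => h (Z t) t).
Proof.
move=> mZ mh _ B mB; rewrite setTI.
have -> : (fun t => h (Z t) t) @^-1` B =
    \bigcup_z ([set t | Z t = z] `&` h z @^-1` B).
  apply/seteqP; split => [t Bt|t [z _ [/= <-]]//].
  by exists (Z t).
apply: countable_bigcupT_measurable => [|z]; first exact: countableP.
apply: measurableI => //.
by rewrite -[X in measurable X]setTI; exact: mh.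
Qed.

Lemma measurable_floor_eq (disp : measure_display) (T : measurableType disp)
  (g : T -> R) (z : int) :
  measurable_fun setT g -> measurable [set t | Num.floor (g t) = z].
Proof.
move=> mg.
have -> : [set t | Num.floor (g t) = z] = g @^-1` `[z%:~R, (z + 1)%:~R[.
  apply/seteqP; split => t /=; rewrite in_itv/= => h.
    by rewrite -real_floor_eq ?num_real// h.
  by apply/eqP; rewrite real_floor_eq ?num_real.
by rewrite -[X in measurable X]setTI; exact: mg.
Qed.

(** The index in the grid of mesh [1/(N+1)] of the corner below [x]. *)
Definition lattice_point (N : nat) (x : 'rV[R]_d) : 'rV[int]_d :=
  \row_j Num.floor (N.+1%:R * x 0 j).

Lemma cvg_lattice_point (x : 'rV[R]_d) :
  (\row_j ((lattice_point N x 0 j)%:~R / N.+1%:R)) @[N --> \oo] --> x.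
Proof.
apply/cvgrPdist_le => e e0.
have := @cvg_harmonic R => /cvgrPdist_le/(_ e e0); apply: filterS => N.
rewrite sub0r normrN ger0_norm ?harmonic_ge0// /harmonic/= => Ne.
rewrite /Num.Def.normr/= mx_normrE (bigmax_le _ (ltW e0))//= => -[i j] _.
rewrite !mxE/= ord1; apply: le_trans Ne.
have N0 : 0 < N.+1%:R :> R by rewrite ltr0n.
set y := _ * x 0 j.
have -> : x 0 j = y / N.+1%:R by rewrite /y mulrC mulKf ?gt_eqF.
rewrite -mulrBl normrM.
rewrite [X in _ * X]gtr0_norm ?invr_gt0// ler_piMl ?invr_ge0 ?(ltW N0)//.
have /andP[h1 h2] : (Num.floor y)%:~R <= y < (Num.floor y + 1)%:~R.
  by rewrite -real_floor_eq ?num_real.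
by move: h2; rewrite intrD ger0_norm ?subr_ge0// => h2; rewrite lerBlDr addrC ltW.
Qed.

(** A function of two variables which is continuous in the first and measurable
    in the second is the limit of its values at the grid points approximating
    the first argument, of which there are countably many. *)
Lemma measurable_fun_Caratheodory (disp : measure_display)
  (T : measurableType disp) (Y : T -> 'rV[R]_d) (h : 'rV[R]_d -> T -> R) :
  measurable_mx Y ->
  (forall x, measurable_fun setT (h x)) ->
  (forall t, continuous (h ^~ t)) ->
  measurable_fun setT (fun t => h (Y t) t).
Proof.
move=> mY mh ch.
pose q N (z : 'rV[int]_d) : 'rV[R]_d := \row_j ((z 0 j)%:~R / N.+1%:R).
apply: (measurable_fun_cvg (h := fun N t => h (q N (lattice_point N (Y t))) t)).
- move=> N; apply: (measurable_fun_countable_param (h := fun z => h (q N z))) => // z.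
  have -> : [set t | lattice_point N (Y t) = z] =
      \bigcap_(j in [set: 'I_d]) [set t | Num.floor (N.+1%:R * Y t 0 j) = z 0 j].
    apply/seteqP; split => [t /= <- j _|t h0] /=; first by rewrite mxE.
    by apply/rowP => j; rewrite mxE; exact: h0.
  apply: fin_bigcap_measurable => // j _; apply: measurable_floor_eq.
  by apply: measurable_funM => //; exact: measurable_cst.
- move=> t _ A /(ch t (Y t)) hA.
  exact: (@cvg_lattice_point (Y t) _ hA).
Qed.

End Caratheodory.

(** * Independent groups of sources and decoupling *)

Section Independence.
Context {disp : measure_display} {Omega : measurableType disp} {R : realType}.
Variable P : probability Omega R.
Implicit Types C D : set (set Omega).

Definition indep_classes C D : Prop :=
  forall E F, C E -> D F -> P (E `&` F) = (P E * P F)%E.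

Lemma indep_classesC C D : indep_classes C D -> indep_classes D C.
Proof. by move=> CD E F DE CF; rewrite setIC muleC; exact: CD. Qed.

(** For fixed [F], both sides are finite measures in [E] which agree on a
    pi-system. *)
Lemma indep_sigma_left C D : C `<=` measurable -> D `<=` measurable ->
  setI_closed C -> C setT -> indep_classes C D -> indep_classes <<s C >> D.
Proof.
move=> mC mD CI CT CD E F CE DF.
have mF := mD _ DF.
have PF : P F = (fine (P F))%:E by rewrite fineK ?fin_num_measure.
pose r : {nonneg R} := NngNum (fine_ge0 (measure_ge0 P F)).
suff -> : P (E `&` F) = mscale r P E by rewrite PF muleC.
apply: (g_sigma_algebra_measure_unique C mC (fun=> setT) _ _
  (mrestr P mF) (mscale r P) CI) => //.
- by rewrite bigcup_const.
- by move=> A CA; have := CD _ _ CA DF; rewrite PF muleC.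
- move=> _; apply: le_lt_trans (ltry 1).
  exact: probability_le1 (measurableI _ _ measurableT mF).
Qed.

Lemma indep_sigma C D : C `<=` measurable -> D `<=` measurable ->
  setI_closed C -> C setT -> setI_closed D -> D setT ->
  indep_classes C D -> indep_classes <<s C >> <<s D >>.
Proof.
move=> mC mD CI CT DI DT CD.
apply: indep_sigma_left => //.
  exact: smallest_sub (@sigma_algebra_measurable _ Omega) mD.
exact/indep_classesC/indep_sigma_left/indep_classesC.
Qed.

Section Grouping.
Variables (I : eqType) (G : I -> set (set Omega)).
Hypothesis sG : forall i, sigma_algebra setT (G i).
Hypothesis mG : forall i, G i `<=` measurable.
Hypothesis indepG : mutually_independent P G.
Implicit Types A B : set I.

(** The events which constrain finitely many members of the group [A], as a
    pi-system generating the sigma-algebra of the group.  The constraint is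
    padded with the full set off the finite support [s], so that two such events
    can be intersected member by member. *)
Let cylinder A : set (set Omega) := [set F | exists s E,
  [/\ uniq s, (forall a, a \in s -> A a), (forall a, G a (E a)),
    (forall a, a \notin s -> E a = setT) & F = \bigcap_(a in [set` s]) E a]].

Let GT i : G i setT.
Proof. by have [G0 /(_ _ G0)] := sG i; rewrite setD0. Qed.

Let cylinder_measurable A : cylinder A `<=` measurable.
Proof.
move=> _ [s [E [_ _ GE _ ->]]]; apply: fin_bigcap_measurable => //= a _.
exact: mG (GE a).
Qed.

Let cylinderT A : cylinder A setT.
Proof.
exists [::], (fun=> setT); split => //.
by apply/seteqP; split.
Qed.

Let GI i E F : G i E -> G i F -> G i (E `&` F).
Proof.
move=> GE GF; rewrite -(sigma_algebra_id (sG i)).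
apply: (@measurableI _ (g_sigma_algebraType (G i))); exact: sub_sigma_algebra.
Qed.

Let bigcap_merge (s t : seq I) (E F : I -> set Omega) :
  (forall a, a \notin s -> E a = setT) -> (forall a, a \notin t -> F a = setT) ->
  \bigcap_(a in [set` s]) E a `&` \bigcap_(a in [set` t]) F a =
  \bigcap_(a in [set` undup (s ++ t)]) (E a `&` F a).
Proof.
move=> ET FT; apply/seteqP; split => [w [hE hF] a /= _|w h].
  split.
    by have [as_|/ET->//] := boolP (a \in s); exact: hE.
  by have [at_|/FT->//] := boolP (a \in t); exact: hF.
split => a /= ast; have /h[] // : [set` undup (s ++ t)] a;
  by rewrite /= mem_undup mem_cat ast ?orbT.
Qed.

Let cylinderI A : setI_closed (cylinder A).
Proof.
move=> _ _ [s [E [us sA GE ET ->]]] [t [F [ut tA GF FT ->]]].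
exists (undup (s ++ t)), (fun a => E a `&` F a); split => //.
- exact: undup_uniq.
- by move=> a; rewrite mem_undup mem_cat => /orP[/sA|/tA].
- by move=> a; exact: GI.
- move=> a; rewrite mem_undup mem_cat negb_or => /andP[/ET-> /FT->].
  by rewrite setIT.
- exact: bigcap_merge.
Qed.

Let indep_cylinder A B : A `&` B = set0 ->
  indep_classes (cylinder A) (cylinder B).
Proof.
move=> AB0 E0 F0 AE0 BF0.
have mE0 := cylinder_measurable AE0; have mF0 := cylinder_measurable BF0.
rewrite -[LHS]fineK ?fin_num_measure//; last exact: measurableI.
rewrite -[P E0]fineK ?fin_num_measure// -[P F0]fineK ?fin_num_measure//.
rewrite -EFinM; congr EFin.
case: AE0 {mE0} => s [E [us sA GE ET ->]]; case: BF0 {mF0} => t [F [ut tB GF FT ->]].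
have st a : a \in s -> a \notin t.
  move=> /sA Aa; apply/negP => /tB Ba.
  by have : (A `&` B) a by []; rewrite AB0.
have ust : uniq (s ++ t).
  rewrite cat_uniq us ut andbT/=; apply/hasPn => a at_; apply/negP => as_.
  by have := st _ as_; rewrite at_.
rewrite bigcap_merge// undup_id//.
rewrite indepG//; last by move=> a _; exact: GI.
rewrite big_cat/=; congr (_ * _); rewrite indepG//.
  by rewrite 2!big_seq; apply: eq_bigr => a /st /FT ->; rewrite setIT.
rewrite 2!big_seq; apply: eq_bigr => a at_; rewrite ET ?setTI//.
by apply/negP => /st; rewrite at_.
Qed.

Let gen_cylinder A : <<s \bigcup_(a in A) G a >> `<=` <<s cylinder A >>.
Proof.
apply: smallest_sub; first exact: smallest_sigma_algebra.
move=> E [a Aa GE]; apply: sub_sigma_algebra.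
exists [:: a], (fun b => if b == a then E else setT); split => //.
- by move=> b; rewrite inE => /eqP->.
- by move=> b; case: eqP => [->|_].
- by move=> b; rewrite inE => /negbTE->.
- apply/seteqP; split => [w Ew b /=|w /(_ a)/=].
    by rewrite inE => ->.
  by rewrite inE eqxx; apply.
Qed.

Lemma indep_groups A B : A `&` B = set0 ->
  indep_classes <<s \bigcup_(a in A) G a >> <<s \bigcup_(a in B) G a >>.
Proof.
move=> AB0 E F /gen_cylinder AE /gen_cylinder BF; move: E F AE BF.
exact/indep_sigma/indep_cylinder.
Qed.

End Grouping.

Lemma pushforward_integral (disp' : measure_display) (T : measurableType disp')
  (phi : Omega -> T) (mphi : measurable_fun setT phi) (h : T -> \bar R) :
  measurable_fun setT h ->
  (\int[pushforward P phi]_t h t = \int[P]_w h (phi w))%E.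
Proof.
move=> mh; rewrite [LHS]integralE [RHS]integralE.
congr (_ - _)%E; rewrite ge0_integral_pushforward ?preimage_setT//.
- by rewrite -funepos_comp.
- exact: measurable_funepos.
- by rewrite -funeneg_comp.
- exact: measurable_funeneg.
Qed.

Section Decoupling.
Variables G1 G2 : set (set Omega).
Hypotheses (mG1 : <<s G1 >> `<=` measurable) (mG2 : <<s G2 >> `<=` measurable).
Hypothesis indepG : indep_classes <<s G1 >> <<s G2 >>.
Local Notation T1 := (g_sigma_algebraType G1).
Local Notation T2 := (g_sigma_algebraType G2).

(** Independence lets the two arguments of [U] vary separately.  Both factors of
    the product are the sample space itself, with smaller sigma-algebras, so
    that no law of a random vector has to be introduced: by independence the
    image of [P] under the diagonal is a product measure, and Fubini's theorem
    applies to it. *)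
Lemma decoupling (U : T1 -> T2 -> R) (v : Omega -> R) :
  measurable_fun [set: T1 * T2] (fun z => U z.1 z.2) ->
  P.-integrable setT (fun w => (U w w)%:E) ->
  (forall w1, (\int[P]_w2 (U w1 w2)%:E = (v w1)%:E)%E) ->
  P.-integrable setT (EFin \o v) /\
  (\int[P]_w (U w w)%:E = \int[P]_w (v w)%:E)%E.
Proof.
move=> mU iU Uv.
pose id1 : Omega -> T1 := id; pose id2 : Omega -> T2 := id.
have mid1 : measurable_fun setT id1 by move=> _ B mB; rewrite setTI; exact: mG1.
have mid2 : measurable_fun setT id2 by move=> _ B mB; rewrite setTI; exact: mG2.
pose X1 : {mfun Omega >-> T1} := HB.pack id1 (isMeasurableFun.Build _ _ _ _ _ mid1).
pose X2 : {mfun Omega >-> T2} := HB.pack id2 (isMeasurableFun.Build _ _ _ _ _ mid2).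
pose P1 := distribution P X1; pose P2 := distribution P X2.
pose diag : Omega -> T1 * T2 := fun w => (id1 w, id2 w).
have mdiag : measurable_fun setT diag by exact: measurable_fun_pair.
pose f : T1 * T2 -> \bar R := fun z => (U z.1 z.2)%:E.
have mf : measurable_fun setT f by exact/measurable_EFinP.
have law A : measurable A -> (P1 \x P2)%E A = pushforward P diag A.
  apply: product_measure_unique => B C mB mC.
  exact: indepG.
have if_ : (pushforward P diag).-integrable setT f.
  by apply: integrable_pushforward => //; rewrite preimage_setT.
have ip : (P1 \x P2)%E.-integrable setT f.
  apply/integrableP; split => //.
  have /integrableP[_] := if_; congr (_ < _)%E.
  by apply: eq_measure_integral => A mA _; exact/esym/law.
have FE : fubini_F P2 f = EFin \o v.
  apply/funext => w1; rewrite /fubini_F /= -Uv.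
  rewrite /P2 /distribution pushforward_integral//.
  by apply: measurableT_comp mf _; exact: measurable_pair1.
have i1 := integrable_fubini_F ip.
have e1 := integral12_prod_meas1 ip.
rewrite FE in i1 e1.
have mv : measurable_fun [set: T1] (EFin \o v) by have /integrableP[] := i1.
split.
  have mv' : measurable_fun [set: Omega] (EFin \o v) by exact: (measurableT_comp mv mid1).
  apply/integrableP; split => //.
  have /integrableP[_] := i1; rewrite /P1 /distribution pushforward_integral//.
  exact: measurableT_comp.
transitivity (\int[pushforward P diag]_z f z)%E.
  exact: esym (pushforward_integral mdiag mf).
rewrite -(@eq_measure_integral _ _ _ setT (pushforward P diag) (P1 \x P2)%E)//; last first.
  by move=> A mA _; exact: law.
by rewrite -e1 /P1 /distribution pushforward_integral.
Qed.

End Decoupling.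
End Independence.
(** * Real random variables with a finite mean *)

Section Mean.
Context {disp : measure_display} {Omega : measurableType disp} {R : realType}.
Variable P : probability Omega R.
Implicit Types (X Y : Omega -> R) (a b c : R).

(** A relation carrying integrability, so that linearity and monotonicity of the
    expectation have no side conditions and stay in the reals. *)
Definition has_mean X (a : R) : Prop :=
  P.-integrable setT (EFin \o X) /\ (\int[P]_w (X w)%:E = a%:E)%E.

Lemma has_mean_measurable X a : has_mean X a -> measurable_fun setT X.
Proof. by move=> [/integrableP[/measurable_EFinP]]. Qed.

Lemma integrable_has_mean X : P.-integrable setT (EFin \o X) ->
  has_mean X (fine (\int[P]_w (X w)%:E)%E).
Proof. by move=> iX; split => //; rewrite fineK//; exact: integrable_fin_num. Qed.

Lemma has_mean_unique X a b : has_mean X a -> has_mean X b -> a = b.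
Proof. by move=> [_ h] [_]; rewrite h => -[]. Qed.

Lemma has_mean_ext X Y a : X =1 Y -> has_mean X a -> has_mean Y a.
Proof. by move=> /funext ->. Qed.

Lemma has_mean_cst a : has_mean (fun=> a) a.
Proof.
split; first exact: finite_measure_integrable_cst.
by rewrite integral_cst//= probability_setT mule1.
Qed.

Lemma has_meanD X Y a b : has_mean X a -> has_mean Y b ->
  has_mean (fun w => X w + Y w) (a + b).
Proof.
move=> [iX EX] [iY EY]; split; first exact: (integrableD measurableT iX iY).
by under eq_integral do rewrite EFinD; rewrite integralD// EX EY.
Qed.

Lemma has_meanZ X a c : has_mean X a -> has_mean (fun w => c * X w) (c * a).
Proof.
move=> [iX EX]; split; first exact: (integrableZl measurableT c iX).
by under eq_integral do rewrite EFinM; rewrite integralZl// EX.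
Qed.

Lemma has_meanB X Y a b : has_mean X a -> has_mean Y b ->
  has_mean (fun w => X w - Y w) (a - b).
Proof.
move=> hX hY; rewrite -[- b]mulN1r.
by apply: has_mean_ext (has_meanD hX (has_meanZ (-1) hY)) => w; rewrite mulN1r.
Qed.

Lemma has_mean_sum (I : Type) (s : seq I) (X : I -> Omega -> R) (a : I -> R) :
  (forall i, has_mean (X i) (a i)) ->
  has_mean (fun w => \sum_(i <- s) X i w) (\sum_(i <- s) a i).
Proof.
move=> h; elim: s => [|i s IH].
  by rewrite big_nil; under eq_fun do rewrite big_nil; exact: has_mean_cst.
rewrite big_cons; under eq_fun do rewrite big_cons.
exact: has_meanD.
Qed.

Lemma has_mean_ge0 X a : {ae P, forall w, 0 <= X w} -> has_mean X a -> 0 <= a.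
Proof.
move=> X0 hX; have mX := has_mean_measurable hX; case: hX => _ EX.
rewrite -lee_fin -EX (@ae_eq_integral _ _ _ _ setT (fun w => `|X w|%:E)%E)//.
- by apply: integral_ge0 => w _; rewrite lee_fin.
- exact/measurable_EFinP.
- by apply/measurable_EFinP; exact: measurableT_comp.
- by apply: filterS X0 => w Xw _; rewrite ger0_norm.
Qed.

Lemma le_has_mean X Y a b : {ae P, forall w, X w <= Y w} ->
  has_mean X a -> has_mean Y b -> a <= b.
Proof.
move=> XY hX hY; rewrite -subr_ge0; apply: has_mean_ge0 (has_meanB hY hX).
by apply: filterS XY => w; rewrite subr_ge0.
Qed.

Lemma dominated_has_mean X Y b : measurable_fun setT X ->
  {ae P, forall w, `|X w| <= Y w} -> has_mean Y b -> exists a, has_mean X a.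
Proof.
move=> mX XY hY; exists (fine (\int[P]_w (X w)%:E)%E).
apply: integrable_has_mean; apply/integrableP; split; first exact/measurable_EFinP.
have mY := has_mean_measurable hY.
have [/integrableP[_ iY] _] := hY; apply: le_lt_trans iY.
apply: ae_ge0_le_integral => //.
- by apply/measurable_EFinP; exact: measurableT_comp.
- by apply/measurable_EFinP; exact: measurableT_comp.
- apply: filterS XY => w XYw _; rewrite /= lee_fin.
  by rewrite (le_trans XYw)// ler_norm.
Qed.

Lemma bounded_has_mean X c : measurable_fun setT X ->
  {ae P, forall w, `|X w| <= c} -> exists a, has_mean X a.
Proof. by move=> mX Xc; exact: dominated_has_mean mX Xc (has_mean_cst c). Qed.

Lemma has_mean_EFin X a : has_mean X a -> ('E_P[X] = a%:E)%E.
Proof. by move=> [_ h]; rewrite unlock. Qed.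

Lemma decoupling_mean (G1 G2 : set (set Omega))
  (U : g_sigma_algebraType G1 -> g_sigma_algebraType G2 -> R) (v : Omega -> R) a :
  <<s G1 >> `<=` measurable -> <<s G2 >> `<=` measurable ->
  indep_classes P <<s G1 >> <<s G2 >> ->
  measurable_fun [set: g_sigma_algebraType G1 * g_sigma_algebraType G2]
    (fun z => U z.1 z.2) ->
  has_mean (fun w => U w w) a ->
  (forall w1, has_mean (U w1) (v w1)) ->
  has_mean v a.
Proof.
move=> mG1 mG2 ind mU [iU EU] Uv.
have [iv Ev] := decoupling mG1 mG2 ind mU iU (fun w => (Uv w).2).
by split => //; rewrite -Ev.
Qed.

End Mean.
(** * Moments of the random perturbation *)

Section Perturbation.
Context {disp : measure_display} {Omega : measurableType disp} {R : realType}.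
Variable P : probability Omega R.

Lemma sigma_of_sigma_algebra (disp' : measure_display) (T' : measurableType disp')
  (I : Type) (X : I -> {RV P >-> T'}) : sigma_algebra setT (sigma_of X).
Proof. exact: smallest_sigma_algebra. Qed.

Lemma sigma_of_measurable (disp' : measure_display) (T' : measurableType disp')
  (I : Type) (X : I -> {RV P >-> T'}) : sigma_of X `<=` measurable.
Proof.
apply: smallest_sub (@sigma_algebra_measurable _ Omega) _.
by move=> _ [i _ [B mB <-]]; exact: measurable_funP.
Qed.

Lemma sigma_of_measurable_fun (disp' : measure_display)
  (T' : measurableType disp') (I : Type) (X : I -> {RV P >-> T'})
  (H : set (set Omega)) (i : I) : sigma_of X `<=` <<s H >> ->
  measurable_fun setT (X i : g_sigma_algebraType H -> T').
Proof.
by move=> XH _ B mB; apply: XH; apply: sub_sigma_algebra; exists i => //; exists B.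
Qed.

Lemma expectation_has_mean (X : Omega -> R) (a c : R) :
  ('E_P[X] = c%:E)%E -> has_mean P X a -> has_mean P X c.
Proof. by move=> EX hX; have [] := hX; move: EX; rewrite unlock. Qed.

Section Moments.
Context {n d : nat}.
Variables (phi : 'I_n -> nat -> 'I_d -> {RV P >-> R}) (alpha2 alpha3 : R).
Hypothesis pert : perturbation_assumption phi alpha2 alpha3.
Variables (i : 'I_n) (k : nat).
Local Notation Phi := (perturbation phi i k).

Let phi_bounded j : {ae P, forall w, `|phi i k j w| <= alpha3}.
Proof.
apply: filterS (pert_bound pert i k) => w; apply: le_trans.
by have := frob_norm_entry (Phi w) 0 j; rewrite mxE.
Qed.

Let mphi j : measurable_fun setT (phi i k j).
Proof. exact: measurable_funP. Qed.

(** For two distinct entries, independence and equality in law turn the vanishing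
    mean of their product into the vanishing square of their common mean. *)
Lemma perturbation_mean0 j : has_mean P (phi i k j) 0.
Proof.
have hm j' := bounded_has_mean (mphi j') (phi_bounded j').
have [d1|d1] := eqVneq d 1%N.
  by have [a ha] := hm j; apply: expectation_has_mean ha; exact: (pert_center1 pert).
have [l lj] : exists l, l != j.
  apply/existsP; apply: contraNT d1 => /existsPn d1.
  rewrite -(card_ord d) -(card1 j); apply/eqP/eq_card => l.
  by have := d1 l; rewrite negbK inE => /eqP ->; rewrite !inE eqxx.
have [a ha] := hm j; have [b hb] := hm l.
have ab : a = b.
  have [_ Ea] := ha; have [_ Eb] := hb; apply: EFin_inj; rewrite -Ea -Eb.
  have int_law j' : (\int[P]_w (phi i k j' w)%:E =
      \int[distribution P (phi i k j')]_t t%:E)%E.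
    by rewrite /distribution pushforward_integral.
  rewrite !int_law; apply: eq_measure_integral => B mB _.
  exact: (pert_ident pert).
pose G j' := sigma_of (fun _ : unit => phi i k j').
have sG j' : sigma_algebra setT (G j') by exact: sigma_of_sigma_algebra.
have mG j' : G j' `<=` measurable by exact: sigma_of_measurable.
have jl0 : [set j] `&` [set l] = set0 :> set 'I_d.
  by apply/seteqP; split => // t [/= -> jl]; rewrite jl eqxx in lj.
have iG : mutually_independent P G by move=> s E; exact: (pert_indep pert).
have ind := indep_groups sG mG iG jl0.
have sub1 j' : sigma_of (fun _ : unit => phi i k j') `<=`
    <<s \bigcup_(t in [set j']) G t >>.
  by move=> E GE; apply: sub_sigma_algebra; exists j'.
have mm j' : <<s \bigcup_(t in [set j']) G t >> `<=` measurable.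
  apply: smallest_sub (@sigma_algebra_measurable _ Omega) _.
  by move=> E [t _ /mG].
have hprod : has_mean P (fun w => phi i k j w * phi i k l w) 0.
  have [c hc] : exists c, has_mean P (fun w => phi i k j w * phi i k l w) c.
    apply: (@bounded_has_mean _ _ _ _ _ (alpha3 * alpha3)).
      exact: measurable_funM.
    apply: filterS2 (phi_bounded j) (phi_bounded l) => w h1 h2.
    by rewrite normrM ler_pM.
  apply: expectation_has_mean hc; apply: (pert_orth pert).
  by rewrite eq_sym.
have hab : has_mean P (fun w => phi i k j w * b) 0.
  apply: (decoupling_mean (U := fun w1 w2 => phi i k j w1 * phi i k l w2)
    _ _ ind) hprod _ => //.
    apply: measurable_funM.
      exact: (measurableT_comp (sigma_of_measurable_fun tt (sub1 j)) measurable_fst).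
    exact: (measurableT_comp (sigma_of_measurable_fun tt (sub1 l)) measurable_snd).
  by move=> w1; exact: has_meanZ.
have hab' : has_mean P (fun w => phi i k j w * b) (b * a).
  by apply: has_mean_ext (has_meanZ b ha) => w; rewrite mulrC.
have := has_mean_unique hab hab'; rewrite ab => /esym/eqP.
by rewrite mulf_eq0 orbb => /eqP b0; rewrite b0 in ab; rewrite -ab.
Qed.

Lemma perturbation_covariance j l :
  has_mean P (fun w => phi i k j w * phi i k l w) (if j == l then alpha2 else 0).
Proof.
have [c hc] : exists c, has_mean P (fun w => phi i k j w * phi i k l w) c.
  apply: (@bounded_has_mean _ _ _ _ _ (alpha3 * alpha3)).
    exact: measurable_funM.
  apply: filterS2 (phi_bounded j) (phi_bounded l) => w h1 h2.
  by rewrite normrM ler_pM.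
apply: expectation_has_mean hc; case: eqP => [<-|/eqP jl].
  by under eq_fun do rewrite -expr2; exact: (pert_var pert).
exact: (pert_orth pert).
Qed.

Lemma perturbation_dotv_mean (c : 'rV[R]_d) : has_mean P (fun w => dotv c (Phi w)) 0.
Proof.
have : has_mean P (fun w => \sum_j c 0 j * phi i k j w) (\sum_j c 0 j * 0).
  by apply: has_mean_sum => j; exact/has_meanZ/perturbation_mean0.
rewrite big1 => [|j _]; last by rewrite mulr0.
by apply: has_mean_ext => w; apply: eq_bigr => j _; rewrite mxE.
Qed.

Lemma perturbation_dotv_cov (c u : 'rV[R]_d) :
  has_mean P (fun w => dotv c (Phi w) * dotv (Phi w) u) (alpha2 * dotv c u).
Proof.
have : has_mean P
    (fun w => \sum_j \sum_l (c 0 j * u 0 l) * (phi i k j w * phi i k l w))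
    (\sum_j \sum_l (c 0 j * u 0 l) * (if j == l then alpha2 else 0)).
  apply: has_mean_sum => j; apply: has_mean_sum => l.
  exact/has_meanZ/perturbation_covariance.
rewrite [X in has_mean _ _ X](_ : _ = alpha2 * dotv c u); last first.
  rewrite mulr_sumr; apply: eq_bigr => j _.
  rewrite (bigD1 j)//= eqxx big1 ?addr0 1?mulrC// => l lj.
  by rewrite eq_sym (negbTE lj) mulr0.
apply: has_mean_ext => w; rewrite mulr_suml; apply: eq_bigr => j _.
rewrite mulr_sumr; apply: eq_bigr => l _; rewrite !mxE; ring.
Qed.

Lemma measurable_perturbed (F : 'rV[R]_d -> R) (x : 'rV[R]_d) (gam : R) :
  continuous F -> measurable_fun setT (fun w => F (x + gam *: Phi w)).
Proof.
move=> cF; apply: (measurable_fun_Caratheodory (h := fun y _ => F y)) => //.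
apply: measurable_mxD; first exact: measurable_mx_cst.
apply: measurable_mxZ => i' j; under eq_fun do rewrite mxE.
exact: mphi.
Qed.

Lemma measurable_dotv_perturbation (c : 'rV[R]_d) :
  measurable_fun setT (fun w => dotv c (Phi w)).
Proof. exact: has_mean_measurable (perturbation_dotv_mean c). Qed.

(** In the expansion of [F] at [x], the constant term (with the noise value [z])
    is killed by the zero mean of the perturbation and the linear term returns
    the gradient by its covariance [alpha2 I]; the remainder is bounded since
    the perturbation is. *)
Lemma perturbed_mean_ge (F : 'rV[R]_d -> R) (C gam z : R) (c x : 'rV[R]_d) :
  (forall y, differentiable F y) -> (forall y, differentiable (grad F) y) ->
  0 <= C -> (forall y, spectral_norm (hessian F y) <= C) ->
  exists v, has_mean P (fun w => dotv c (Phi w) * (F (x + gam *: Phi w) + z)) v /\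
    gam * alpha2 * dotv c (grad F x) - C * alpha3 ^+ 3 * gam ^+ 2 * frob_norm c <= v.
Proof.
move=> dF dG C0 HC; have a30 := ltW (pert_alpha3 pert).
pose rem w := dotv c (Phi w) *
  (F (x + gam *: Phi w) - F x - gam * dotv (Phi w) (grad F x)).
set b := C * alpha3 ^+ 3 * gam ^+ 2 * frob_norm c.
have mrem : measurable_fun setT rem.
  apply: measurable_funM; first exact: measurable_dotv_perturbation.
  apply: measurable_funB.
    apply: measurable_funB => //; apply: measurable_perturbed => y.
    exact: differentiable_continuous.
  apply: measurable_funM => //.
  by under eq_fun do rewrite dotvC; exact: measurable_dotv_perturbation.
have rem_le : {ae P, forall w, `|rem w| <= b}.
  apply: filterS (pert_bound pert i k) => w Pw; rewrite normrM.
  have h1 : `|dotv c (Phi w)| <= frob_norm c * alpha3.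
    apply: le_trans (CauchySchwarz_dotv _ _) _.
    by rewrite ler_wpM2l// frob_norm_ge0.
  have h2 : `|F (x + gam *: Phi w) - F x - gam * dotv (Phi w) (grad F x)| <=
      C * (gam ^+ 2 * alpha3 ^+ 2).
    have := Taylor1 x (gam *: Phi w) dF dG HC.
    rewrite [dotv (gam *: _) _]dotvC dotvZr dotvC => /le_trans; apply.
    rewrite ler_wpM2l// frob_normZ exprMn real_normK ?num_real//.
    by rewrite ler_wpM2l ?sqr_ge0// ler_pXn2r ?nnegrE ?frob_norm_ge0.
  apply: le_trans (ler_pM (normr_ge0 _) (normr_ge0 _) h1 h2) _.
  by rewrite le_eqVlt; apply/orP; left; apply/eqP; rewrite /b; ring.
have [r hr] := bounded_has_mean mrem rem_le.
have rb : - b <= r.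
  apply: le_has_mean (has_mean_cst P (- b)) hr.
  by apply: filterS rem_le => w; rewrite ler_norml => /andP[].
have h0 := has_meanZ (F x + z) (perturbation_dotv_mean c).
have h1 := has_meanZ gam (perturbation_dotv_cov c (grad F x)).
exists ((F x + z) * 0 + gam * (alpha2 * dotv c (grad F x)) + r); split.
  apply: has_mean_ext (has_meanD (has_meanD h0 h1) hr) => w.
  by rewrite /rem; ring.
by rewrite mulr0 add0r mulrA lerD2l.
Qed.

End Moments.
End Perturbation.
(** * Mean and consensus error of the rows of a matrix *)

Section RowMean.
Context {R : realType} {n d : nat}.

Lemma row_meanE (M : 'M[R]_(n, d)) : row_mean M = n%:R^-1 *: \sum_i row i M.
Proof.
congr (_ *: _); apply/rowP => j; rewrite mxE summxE.
by apply: eq_bigr => i _; rewrite !mxE mul1r.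
Qed.

Lemma row_meanD (M N : 'M[R]_(n, d)) : row_mean (M + N) = row_mean M + row_mean N.
Proof. by rewrite /row_mean mulmxDr scalerDr. Qed.

Lemma row_meanZ (a : R) (M : 'M[R]_(n, d)) : row_mean (a *: M) = a *: row_mean M.
Proof. by rewrite /row_mean -scalemxAr !scalerA mulrC. Qed.

Lemma row_meanB (M N : 'M[R]_(n, d)) : row_mean (M - N) = row_mean M - row_mean N.
Proof. by rewrite row_meanD -scaleN1r row_meanZ scaleN1r. Qed.

Lemma row_mean_stochastic (W : 'M[R]_n) (M : 'M[R]_(n, d)) :
  (ones n)^T *m W = (ones n)^T -> row_mean (W *m M) = row_mean M.
Proof. by move=> W1; rewrite /row_mean mulmxA W1. Qed.

Lemma dotv_row_mean (c : 'rV[R]_d) (M : 'M[R]_(n, d)) :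
  dotv c (row_mean M) = n%:R^-1 * \sum_i dotv c (row i M).
Proof. by rewrite row_meanE dotvZr dotv_sumr. Qed.

Lemma row_mean_ones (u : 'rV[R]_d) : (0 < n)%N -> row_mean (ones n *m u) = u.
Proof.
move=> n0; apply/rowP => j; rewrite !mxE.
under eq_bigr => i _ do rewrite !mxE mul1r big_ord1 mxE mul1r.
by rewrite sumr_const card_ord -[u 0 j *+ n]mulr_natl mulKf// pnatr_eq0 -lt0n.
Qed.

Lemma row_mean_consensus (M : 'M[R]_(n, d)) : (0 < n)%N ->
  row_mean (consensus_error M) = 0.
Proof. by move=> n0; rewrite row_meanB row_mean_ones// subrr. Qed.

Lemma consensus_errorB (M N : 'M[R]_(n, d)) :
  consensus_error (M - N) = consensus_error M - consensus_error N.
Proof. by rewrite /consensus_error row_meanB mulmxBr !opprD !opprK addrACA. Qed.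

Lemma consensus_errorZ (a : R) (M : 'M[R]_(n, d)) :
  consensus_error (a *: M) = a *: consensus_error M.
Proof. by rewrite /consensus_error row_meanZ -scalemxAr scalerBr. Qed.

Lemma consensus_error_stochastic (W : 'M[R]_n) (M : 'M[R]_(n, d)) :
  W *m ones n = ones n -> (ones n)^T *m W = (ones n)^T ->
  consensus_error (W *m M) = W *m consensus_error M.
Proof.
move=> W1 W1'.
by rewrite /consensus_error row_mean_stochastic// mulmxBr mulmxA W1.
Qed.

Lemma row_consensus (M : 'M[R]_(n, d)) i :
  row i M = row_mean M + row i (consensus_error M).
Proof.
rewrite linearB/= row_mul addrC -[LHS](subrK (row i (ones n) *m row_mean M)).
congr (_ + _); apply/rowP => j.
by rewrite mxE big_ord1 !mxE mul1r.
Qed.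

Lemma frob_norm_mx_norm (u : 'rV[R]_d) : frob_norm u <= Num.sqrt d%:R * `|u|.
Proof.
rewrite -(ler_pXn2r (isT : (0 < 2)%N)) ?nnegrE ?mulr_ge0 ?frob_norm_ge0//.
rewrite sqr_frob_norm big_ord1 exprMn sqr_sqrtr//.
apply: (@le_trans _ _ (\sum_(j < d) `|u| ^+ 2)).
  apply: ler_sum => j _; rewrite -real_normK ?num_real//.
  rewrite ler_pXn2r ?nnegrE// [leRHS]/Num.Def.normr/= mx_normrE.
  exact: (le_bigmax _ _ (0, j)).
by rewrite sumr_const card_ord -[leLHS]mulr_natl.
Qed.

Lemma frob_Lipschitz_continuous (h : 'rV[R]_d -> R) (L : R) :
  (forall x x', `|h x - h x'| <= L * frob_norm (x - x')) -> continuous h.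
Proof.
move=> hL x; apply/(cvgrPdist_le (FF := nbhs_filter x)) => e e0.
pose K := `|L| * Num.sqrt d%:R + 1.
have K0 : 0 < K by rewrite ltr_wpDl// mulr_ge0.
have /cvgrPdist_le/(_ _ (divr_gt0 e0 K0)) : (fun y : 'rV[R]_d => y) @ x --> x.
  exact: cvg_id.
apply: filterS => y xy; apply: le_trans (hL x y) _.
apply: (@le_trans _ _ (`|L| * (Num.sqrt d%:R * `|x - y|))).
  apply: (@le_trans _ _ (`|L| * frob_norm (x - y))).
    by rewrite ler_wpM2r ?frob_norm_ge0// ler_norm.
  by rewrite ler_wpM2l// frob_norm_mx_norm.
rewrite mulrA; apply: (@le_trans _ _ (K * `|x - y|)).
  by rewrite ler_wpM2r// lerDl.
by rewrite mulrC -ler_pdivlMr.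
Qed.

End RowMean.
(** * One step of the algorithm, conditionally on its past *)

Section OneStep.
Context {disp : measure_display} {Omega : measurableType disp} {R : realType}.
Variable P : probability Omega R.
Context {n d m : nat}.
Variables (f : 'I_n -> 'rV[R]_d -> m.-tuple R -> R)
  (SS : set (m.-tuple R)) (muS : probability (m.-tuple R) R)
  (L : m.-tuple R -> R) (xs : 'rV[R]_d) (W : 'M[R]_n)
  (S : 'I_n -> nat -> {RV P >-> m.-tuple R})
  (phi : 'I_n -> nat -> 'I_d -> {RV P >-> R})
  (zeta : 'I_n -> nat -> {RV P >-> R})
  (alpha1 alpha2 alpha3 : R) (alpha gamma : nat -> R)
  (x0 : 'M[R]_(n, d)) (x y : nat -> Omega -> 'M[R]_(n, d)).
Hypothesis objA : objective_assumption f SS muS xs alpha1.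
Hypothesis locA : local_function_assumption f SS muS L.
Hypothesis procA : process_assumption S SS muS.
Hypothesis pertA : perturbation_assumption phi alpha2 alpha3.
Hypothesis indepA : independent_sources S phi zeta.
Hypothesis algA : is_1PDSGT S phi zeta f W alpha gamma x0 x y.

Implicit Types A B : set (@source n).
Local Notation g := (grad_estimate S phi zeta f gamma x).
Local Notation Phi := (perturbation phi).

Lemma measurable_local_fun (disp' : measure_display) (T : measurableType disp')
  (i : 'I_n) (Y : T -> 'rV[R]_d) (s : T -> m.-tuple R) :
  measurable_mx Y -> measurable_fun setT s -> (forall t, SS (s t)) ->
  measurable_fun setT (fun t => f i (Y t) (s t)).
Proof.
move=> mY ms SSs.
apply: (measurable_fun_Caratheodory (h := fun z t => f i z (s t))).
- exact: mY.
- move=> z; apply: (measurable_comp (proc_meas procA) _ (loc_meas locA i z) ms).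
  by move=> _ [t _ <-].
- move=> t; apply: (@frob_Lipschitz_continuous _ _ _ (L (s t))) => z z'.
  exact: (loc_lipschitz locA).
Qed.

Lemma local_obj_continuous i : continuous (local_obj f SS muS i).
Proof. by move=> z; apply: differentiable_continuous; exact: (obj_diff objA). Qed.

(** [f_i] is only controlled on [SS], so it is extended by zero outside; the
    process never sees the extension. *)
Lemma local_obj_mean (i : 'I_n) (k : nat) (z : 'rV[R]_d) :
  has_mean P (fun w => f i z (S i k w)) (local_obj f SS muS i z).
Proof.
pose h := (EFin \o f i z) \_ SS.
have mSS := proc_meas procA.
have ih : muS.-integrable setT h.
  by have := loc_integrable locA i z; move/(integrable_mkcond _ mSS).
have mh : measurable_fun setT h by have /integrableP[] := ih.
have hE w : h (S i k w) = (f i z (S i k w))%:E.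
  by rewrite /h patchE mem_set//; exact: (proc_values procA).
have law (k' : m.-tuple R -> \bar R) : measurable_fun setT k' ->
    (\int[P]_w k' (S i k w) = \int[muS]_s k' s)%E.
  move=> mk'; rewrite -(pushforward_integral P (measurable_funP (S i k)) mk').
  by apply: eq_measure_integral => B mB _; exact: (proc_law procA).
have E : (\int[P]_w (f i z (S i k w))%:E = (local_obj f SS muS i z)%:E)%E.
  under eq_integral do rewrite -hE.
  rewrite law// /local_obj /Rintegral -integral_mkcond fineK//.
  by apply: integrable_fin_num => //; exact: (loc_integrable locA).
split => //; apply/integrableP; split.
  apply/measurable_EFinP.
  apply: (measurable_comp mSS _ (loc_meas locA i z)) => //.
  by move=> _ [w _ <-]; exact: (proc_values procA).
rewrite (eq_integral (fun w => `|h (S i k w)|%E)); last by move=> w _; rewrite hE.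
rewrite (law (fun s => `|h s|%E)); last exact: measurableT_comp.
by have /integrableP[] := ih.
Qed.

Definition events (A : set (@source n)) : set (set Omega) :=
  \bigcup_(a in A) source_sigma S phi zeta a.

Let source_sigma_algebra a : sigma_algebra setT (source_sigma S phi zeta a).
Proof. by case: a => [[i l]|[l|u]] /=; exact: sigma_of_sigma_algebra. Qed.

Let source_measurable a : source_sigma S phi zeta a `<=` measurable.
Proof. by case: a => [[i l]|[l|u]] /=; exact: sigma_of_measurable. Qed.

Lemma events_measurable A : <<s events A >> `<=` measurable.
Proof.
apply: smallest_sub (@sigma_algebra_measurable _ Omega) _.
by move=> E [a _ /source_measurable].
Qed.

Lemma indep_events A B : A `&` B = set0 ->
  indep_classes P <<s events A >> <<s events B >>.
Proof.
apply: indep_groups => // s E; exact: indepA.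
Qed.

Lemma source_sub_events A a : A a ->
  source_sigma S phi zeta a `<=` <<s events A >>.
Proof. by move=> Aa E aE; apply: sub_sigma_algebra; exists a. Qed.

Lemma measurable_mx_Phi A i l : A (inl (i, l)) ->
  measurable_mx (Phi i l : g_sigma_algebraType (events A) -> _).
Proof.
move=> Aa i' j; under eq_fun do rewrite mxE.
exact: (sigma_of_measurable_fun (X := phi i l) j (source_sub_events (a := inl (i, l)) Aa)).
Qed.

Lemma measurable_process A i l : A (inr (inl l)) ->
  measurable_fun setT (S i l : g_sigma_algebraType (events A) -> _).
Proof. by move=> Aa; exact: (sigma_of_measurable_fun (X := S ^~ l) i
  (source_sub_events (a := inr (inl l)) Aa)). Qed.

Lemma measurable_noise A i l : A (inr (inr tt)) ->
  measurable_fun setT (zeta i l : g_sigma_algebraType (events A) -> R).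
Proof.
by move=> Aa; exact: (sigma_of_measurable_fun (X := fun il => zeta il.1 il.2) (i, l)
  (source_sub_events (a := inr (inr tt)) Aa)).
Qed.

(** The noise at all times counts as known: it is uncorrelated but may be
    dependent in time, and it only enters multiplied by the independent,
    centered perturbation. *)
Definition history (k : nat) : set (@source n) := fun a =>
  match a with
  | inl (_, l) => (l < k)%N
  | inr (inl l) => (l < k)%N
  | inr (inr _) => True
  end.

Lemma historyS k : history k `<=` history k.+1.
Proof. by case=> [[i l]|[l|u]] //=; exact: ltnW. Qed.

Lemma measurable_grad_estimate A k : history k.+1 `<=` A ->
  measurable_mx (x k : g_sigma_algebraType (events A) -> _) ->
  measurable_mx (g k : g_sigma_algebraType (events A) -> _).
Proof.
move=> kA mx i j; under eq_fun do rewrite mxE.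
have APhi : A (inl (i, k)) by apply: kA; exact: leqnn.
have AS : A (inr (inl k)) by apply: kA; exact: leqnn.
have Az : A (inr (inr tt)) by exact: kA.
apply: measurable_funM; first exact: measurable_mx_Phi.
apply: measurable_funD; last exact: measurable_noise.
apply: measurable_local_fun.
- apply: measurable_mxD; first exact: measurable_mx_row.
  exact: measurable_mxZ (measurable_mx_Phi APhi).
- exact: (measurable_process i AS).
- by move=> t; exact: (proc_values procA).
Qed.

(** The tracking variable [y_k] contains the estimate of time [k], so it is one
    step ahead of [x_k]. *)
Lemma measurable_iterates k :
  (forall A, history k `<=` A ->
    measurable_mx (x k : g_sigma_algebraType (events A) -> _)) /\
  (forall A, history k.+1 `<=` A ->
    measurable_mx (y k : g_sigma_algebraType (events A) -> _)).
Proof.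
elim: k => [|k [IHx IHy]].
  have mx A : history 0 `<=` A ->
      measurable_mx (x 0 : g_sigma_algebraType (events A) -> _).
    by move=> _; rewrite (funext (dsgt_x0 algA)); exact: measurable_mx_cst.
  split => // A hA; rewrite (funext (dsgt_y0 algA)).
  by apply: measurable_grad_estimate => //; apply: mx; exact: subset_trans (@historyS 0) hA.
have mx A : history k.+1 `<=` A ->
    measurable_mx (x k.+1 : g_sigma_algebraType (events A) -> _).
  move=> hA; rewrite (funext (dsgt_xS algA k)); apply: measurable_mxM.
  apply: measurable_mxB; last exact: measurable_mxZ (IHy _ hA).
  exact: IHx _ (subset_trans (@historyS k) hA).
split => // A hA; rewrite (funext (dsgt_yS algA k)).
have hA1 := subset_trans (@historyS k.+1) hA.
apply: measurable_mxB; [apply: measurable_mxD|].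
- exact: measurable_mxM (IHy _ hA1).
- exact: measurable_grad_estimate hA (mx _ hA1).
- apply: (measurable_grad_estimate hA1).
  exact: IHx _ (subset_trans (@historyS k) hA1).
Qed.

Local Notation delta k w := (row_mean (x k w) - xs).

Lemma measurable_delta A k : history k `<=` A ->
  measurable_mx ((fun w => delta k w) : g_sigma_algebraType (events A) -> _).
Proof.
move=> hA; apply: measurable_mxB; last exact: measurable_mx_cst.
exact: measurable_mx_mean ((measurable_iterates k).1 A hA).
Qed.

Lemma row_grad_estimate k w i : row i (g k w) =
  (f i (row i (x k w) + gamma k *: Phi i k w) (S i k w) + zeta i k w) *: Phi i k w.
Proof. by apply/rowP => j; rewrite !mxE mulrC. Qed.

(** The sources other than the present and future process form one group; once
    they are fixed, each [f_i] is evaluated at a fixed point and is integrable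
    by assumption. *)
Lemma mean_over_process k a :
  has_mean P (fun w => dotv (delta k w) (row_mean (g k w))) a ->
  has_mean P (fun w => n%:R^-1 * \sum_i dotv (delta k w) (Phi i k w) *
    (local_obj f SS muS i (row i (x k w) + gamma k *: Phi i k w) + zeta i k w)) a.
Proof.
move=> ha.
pose A : set (@source n) := fun s => match s with inr (inl l) => (l < k)%N | _ => True end.
pose B : set (@source n) := [set inr (inl k)].
have AB0 : A `&` B = set0.
  by apply/seteqP; split => // s [As Bs]; move: As; rewrite Bs /A ltnn.
have hA : history k `<=` A by case=> [[]|[]].
have mx := (measurable_iterates k).1 A hA.
have mdelta := measurable_delta hA.
have mPhi i := @measurable_mx_Phi A i k I.
have mzeta i := @measurable_noise A i k I.
have mS i := @measurable_process B i k erefl.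
apply: (decoupling_mean (U := fun w1 w2 => n%:R^-1 * \sum_i
  dotv (delta k w1) (Phi i k w1) *
    (f i (row i (x k w1) + gamma k *: Phi i k w1) (S i k w2) + zeta i k w1))
  (@events_measurable A) (@events_measurable B) (indep_events AB0)).
- apply: measurable_funM => //; apply: measurable_sum => i; apply: measurable_funM.
    apply: measurable_mx_dotv; first exact: measurable_mx_comp measurable_fst mdelta.
    exact: measurable_mx_comp measurable_fst (mPhi i).
  apply: measurable_funD; last exact: measurableT_comp (mzeta i) measurable_fst.
  apply: measurable_local_fun.
  + apply: measurable_mxD.
      exact: measurable_mx_comp measurable_fst (measurable_mx_row i mx).
    exact: measurable_mxZ (measurable_mx_comp measurable_fst (mPhi i)).
  + exact: measurableT_comp (mS i) measurable_snd.
  + by move=> t; exact: (proc_values procA).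
- apply: has_mean_ext ha => w; rewrite dotv_row_mean; congr (_ * _).
  by apply: eq_bigr => i _; rewrite row_grad_estimate dotvZr mulrC.
- move=> w1; apply/has_meanZ/has_mean_sum => i; apply/has_meanZ/has_meanD.
    exact: local_obj_mean.
  exact: has_mean_cst.
Qed.

(** Here the fresh perturbations of all agents form one group, against the
    history.  The sum over the agents is averaged term by term, and each term
    involves the perturbation of a single agent. *)
Lemma mean_over_perturbation k a :
  has_mean P (fun w => n%:R^-1 * \sum_i dotv (delta k w) (Phi i k w) *
    (local_obj f SS muS i (row i (x k w) + gamma k *: Phi i k w) + zeta i k w)) a ->
  exists v, has_mean P v a /\ forall w,
    n%:R^-1 * \sum_i (gamma k * alpha2 *
      dotv (delta k w) (grad (local_obj f SS muS i) (row i (x k w))) -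
      alpha1 * alpha3 ^+ 3 * gamma k ^+ 2 * frob_norm (delta k w)) <= v w.
Proof.
move=> ha.
pose B : set (@source n) := fun s => match s with inl (_, l) => l = k | _ => False end.
have AB0 : history k `&` B = set0.
  apply/seteqP; split => // -[[i l]|[l|u]] [] //= h1 h2.
  by rewrite h2 ltnn in h1.
have mx := (measurable_iterates k).1 (history k) (@subset_refl _ _).
have mdelta := measurable_delta (@subset_refl _ (history k)).
have mzeta i := @measurable_noise (history k) i k I.
have mPhi i := @measurable_mx_Phi B i k erefl.
have vP w i := perturbed_mean_ge pertA i k (gamma k) (zeta i k w) (delta k w)
  (row i (x k w)) (obj_diff objA i) (obj_grad_diff objA i)
  (ltW (obj_alpha1 objA)) (obj_hess_bound objA i).
pose v w i := sval (cid (vP w i)).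
exists (fun w => n%:R^-1 * \sum_i v w i); split; last first.
  move=> w; rewrite ler_wpM2l ?invr_ge0//; apply: ler_sum => i _.
  by have [] := svalP (cid (vP w i)).
apply: (decoupling_mean (U := fun w1 w2 => n%:R^-1 * \sum_i
  dotv (delta k w1) (Phi i k w2) *
    (local_obj f SS muS i (row i (x k w1) + gamma k *: Phi i k w2) + zeta i k w1))
  (@events_measurable (history k)) (@events_measurable B) (indep_events AB0)).
- apply: measurable_funM => //; apply: measurable_sum => i; apply: measurable_funM.
    apply: measurable_mx_dotv; first exact: measurable_mx_comp measurable_fst mdelta.
    exact: measurable_mx_comp measurable_snd (mPhi i).
  apply: measurable_funD; last exact: measurableT_comp (mzeta i) measurable_fst.
  apply: (measurable_fun_Caratheodory (h := fun z _ => local_obj f SS muS i z)) => //.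
    apply: measurable_mxD.
      exact: measurable_mx_comp measurable_fst (measurable_mx_row i mx).
    exact: measurable_mxZ (measurable_mx_comp measurable_snd (mPhi i)).
  by move=> _; exact: local_obj_continuous.
- exact: ha.
- move=> w1; apply/has_meanZ/has_mean_sum => i.
  by have [] := svalP (cid (vP w1 i)).
Qed.

(** * The mean-square recursion *)

Section Recursion.
Variables (e : rel 'I_n) (lambda : R).
Hypothesis n_gt0 : (0 < n)%N.
Hypothesis graphA : graph_assumption e W.
Hypothesis scA : strong_convexity f SS muS xs lambda.

Lemma row_mean_tracking k w : row_mean (y k w) = row_mean (g k w).
Proof.
elim: k => [|k IH]; first by rewrite (dsgt_y0 algA).
rewrite (dsgt_yS algA) row_meanB row_meanD (row_mean_stochastic _ (graph_col_stoch graphA)).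
by rewrite IH addrAC subrr add0r.
Qed.

Lemma deltaS k w : delta k.+1 w = delta k w - alpha k *: row_mean (g k w).
Proof.
rewrite (dsgt_xS algA) (row_mean_stochastic _ (graph_col_stoch graphA)).
by rewrite row_meanB row_meanZ row_mean_tracking addrAC.
Qed.

Lemma consensus_errorS k w : consensus_error (x k.+1 w) =
  W *m (consensus_error (x k w) - alpha k *: consensus_error (y k w)).
Proof.
rewrite (dsgt_xS algA) consensus_error_stochastic.
- by rewrite consensus_errorB consensus_errorZ.
- exact: (graph_row_stoch graphA).
- exact: (graph_col_stoch graphA).
Qed.

(** Moving every gradient to the mean point makes the global objective appear,
    to which strong convexity applies. *)
Lemma mean_grad_ge k w :
  lambda * frob_norm (delta k w) ^+ 2 -
    alpha1 * frob_norm (consensus_error (x k w)) * frob_norm (delta k w) <=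
  n%:R^-1 * \sum_i dotv (delta k w) (grad (local_obj f SS muS i) (row i (x k w))).
Proof.
have nR : 0 < n%:R :> R by rewrite ltr0n.
have a1 := ltW (obj_alpha1 objA).
have grad_global z : dotv (delta k w) (grad (global_obj f SS muS) z) =
    n%:R^-1 * \sum_i dotv (delta k w) (grad (local_obj f SS muS i) z).
  rewrite [X in grad X](_ : _ =
      (fun y => n%:R^-1 * \sum_i local_obj f SS muS i y)) // grad_mean.
    by rewrite dotvZr dotv_sumr.
  by move=> i; exact: (obj_diff objA).
have := scA.2 (row_mean (x k w)); rewrite dotvC grad_global => sc.
rewrite lerBlDr (le_trans sc)// -lerBlDl -mulrBr -sumrB.
rewrite mulrC ler_pdivrMr//.
apply: (@le_trans _ _ (\sum_(i < n) (alpha1 * frob_norm (consensus_error (x k w)) *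
    frob_norm (delta k w)))); last first.
  by rewrite sumr_const card_ord -[leLHS]mulr_natr.
apply: ler_sum => i _; rewrite -dotvBr; apply: le_trans (ler_norm _) _.
rewrite -normrN -mulN1r -dotvZr scaleN1r opprB (row_consensus (x k w) i).
apply: le_trans (grad_Lipschitz _ _ _ (obj_grad_diff objA i) (obj_hess_bound objA i)) _.
rewrite -mulrA ler_wpM2l// ler_wpM2r ?frob_norm_ge0//.
exact: frob_norm_row_le.
Qed.

Let A := lambda * alpha2.
Let C1 := alpha2 * alpha1.
Let C2 := alpha1 * alpha3 ^+ 3.

Let A_gt0 : 0 < A.
Proof. by rewrite mulr_gt0 ?(pert_alpha2 pertA)//; case: scA. Qed.

(** Young's inequality on the two errors linear in [|delta|], spending a quarter
    of the strong convexity. *)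
Lemma descent_pointwise (k : nat) (w : Omega) (E : R) : 0 <= gamma k ->
  frob_norm (consensus_error (x k w)) ^+ 2 <= E ->
  gamma k * (3 / 4 * A * frob_norm (delta k w) ^+ 2 -
    2 / A * (C1 ^+ 2 * E + C2 ^+ 2 * gamma k ^+ 2)) <=
  n%:R^-1 * \sum_i (gamma k * alpha2 *
    dotv (delta k w) (grad (local_obj f SS muS i) (row i (x k w))) -
    alpha1 * alpha3 ^+ 3 * gamma k ^+ 2 * frob_norm (delta k w)).
Proof.
move=> g0 eE; have := mean_grad_ge k w; have nR : n%:R != 0 :> R by rewrite pnatr_eq0 -lt0n.
rewrite sumrB -mulr_sumr sumr_const card_ord.
set T := \sum_i _; set c := frob_norm (consensus_error _) in eE *.
set z := frob_norm (delta k w) => h.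
rewrite [leRHS](_ : _ = gamma k * (alpha2 * (n%:R^-1 * T) - C2 * gamma k * z)); last first.
  by rewrite -/C2 -[X in _ - X]mulr_natl; field.
rewrite ler_wpM2l//.
have a20 := ltW (pert_alpha2 pertA).
apply: (@le_trans _ _ (A * z ^+ 2 - (C1 * c + C2 * gamma k) * z)); last first.
  have := ler_wpM2l a20 h; rewrite /A /C1; lra.
set p := C1 * c; set q := C2 * gamma k.
have pE : p ^+ 2 <= C1 ^+ 2 * E by rewrite exprMn ler_wpM2l// sqr_ge0.
have -> : C2 ^+ 2 * gamma k ^+ 2 = q ^+ 2 by rewrite /q [RHS]exprMn.
have AV : 0 < A^-1 by rewrite invr_gt0.
(* [(p + q) z <= A/4 z^2 + (p + q)^2 / A], then [(p + q)^2 <= 2 p^2 + 2 q^2]. *)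
have h1 : 0 <= A^-1 * (A / 2 * z - (p + q)) ^+ 2 by rewrite mulr_ge0 ?sqr_ge0 ?ltW.
have h2 : 0 <= A^-1 * (p - q) ^+ 2 by rewrite mulr_ge0 ?sqr_ge0 ?ltW.
have h3 : 0 <= A^-1 * (C1 ^+ 2 * E - p ^+ 2) by apply: mulr_ge0; [exact: ltW|rewrite subr_ge0].
have e1 : A^-1 * (A / 2 * z - (p + q)) ^+ 2 =
    A / 4 * z ^+ 2 - (p + q) * z + A^-1 * (p + q) ^+ 2.
  by field; rewrite gt_eqF.
rewrite e1 in h1; lra.
Qed.

Lemma measurable_mx_ambient (B : set (@source n)) p q (Y : Omega -> 'M[R]_(p, q)) :
  measurable_mx (Y : g_sigma_algebraType (events B) -> _) -> measurable_mx Y.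
Proof.
move=> mY i j _ C mC; apply: (@events_measurable B).
exact: mY measurableT _ mC.
Qed.

Lemma measurable_delta_Omega k : measurable_mx (fun w => delta k w).
Proof.
exact: measurable_mx_ambient (measurable_delta (@subset_refl _ (history k))).
Qed.

Lemma measurable_mean_g_Omega k : measurable_mx (fun w => row_mean (g k w)).
Proof.
apply: measurable_mx_mean.
exact: measurable_mx_ambient (measurable_grad_estimate (@subset_refl _ (history k.+1))
  ((measurable_iterates k).1 _ (@historyS k))).
Qed.

Variable Mbar : R.
Hypothesis g_bounded : forall k,
  ('E_P[fun w => (frob_norm (row_mean (g k w)) ^+ 2)%R] <= Mbar%:E)%E.

Lemma mean_sqr_g k : exists2 M,
  has_mean P (fun w => frob_norm (row_mean (g k w)) ^+ 2) M & M <= Mbar.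
Proof.
have mg : measurable_fun setT (fun w => frob_norm (row_mean (g k w)) ^+ 2).
  under eq_fun do rewrite sqr_frob_norm_row.
  by apply: measurable_mx_dotv; exact: measurable_mean_g_Omega.
have h := g_bounded k; rewrite unlock in h.
have ig : P.-integrable setT (EFin \o (fun w => frob_norm (row_mean (g k w)) ^+ 2)).
  apply/integrableP; split; first exact/measurable_EFinP.
  apply: le_lt_trans (ltry Mbar); apply: le_trans h.
  rewrite le_eqVlt; apply/orP; left; apply/eqP; apply: eq_integral => w _.
  by rewrite /= ger0_norm// sqr_ge0.
have hM := integrable_has_mean ig.
exists (fine (\int[P]_w (frob_norm (row_mean (g k w)) ^+ 2)%:E)%E) => //.
by rewrite -lee_fin; case: hM => _ <-.
Qed.

Lemma mean_inner k D : has_mean P (fun w => frob_norm (delta k w) ^+ 2) D ->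
  exists a, has_mean P (fun w => dotv (delta k w) (row_mean (g k w))) a.
Proof.
move=> hD; have [M hM _] := mean_sqr_g k.
apply: (dominated_has_mean _ _ (has_meanD hD hM)).
  apply: measurable_mx_dotv; first exact: measurable_delta_Omega.
  exact: measurable_mean_g_Omega.
apply: nearW => w; apply: le_trans (CauchySchwarz_dotv _ _) _.
set a := frob_norm _; set b := frob_norm _.
have := sqr_ge0 (a - b); have := sqr_ge0 (a + b); nra.
Qed.

Lemma sqr_deltaS k w : frob_norm (delta k.+1 w) ^+ 2 =
  frob_norm (delta k w) ^+ 2 -
  2 * alpha k * dotv (delta k w) (row_mean (g k w)) +
  alpha k ^+ 2 * frob_norm (row_mean (g k w)) ^+ 2.
Proof.
rewrite deltaS; move: (delta k w) (row_mean (g k w)) => u v.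
rewrite !sqr_frob_norm_row dotvBr dotvZr [dotv (u - _) u]dotvC [dotv (u - _) v]dotvC.
by rewrite !dotvBr !dotvZr [dotv v u]dotvC; ring.
Qed.

(** The finiteness of [E|gbar_k|^2] propagates to [delta_k], which differs from
    its deterministic initial value by finitely many such terms. *)
Lemma mean_sqr_delta_ex k : exists D, has_mean P (fun w => frob_norm (delta k w) ^+ 2) D.
Proof.
elim: k => [|k [D hD]].
  exists (frob_norm (row_mean x0 - xs) ^+ 2).
  by apply: has_mean_ext (has_mean_cst _ _) => w; rewrite (dsgt_x0 algA).
have [a ha] := mean_inner hD; have [M hM _] := mean_sqr_g k.
exists (D - 2 * alpha k * a + alpha k ^+ 2 * M).
apply: has_mean_ext
  (has_meanD (has_meanB hD (has_meanZ _ ha)) (has_meanZ _ hM)) => w.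
by rewrite sqr_deltaS.
Qed.

Lemma mean_sqr_recursion k D D' E : 0 <= alpha k -> 0 <= gamma k ->
  {ae P, forall w, frob_norm (consensus_error (x k w)) ^+ 2 <= E} ->
  has_mean P (fun w => frob_norm (delta k w) ^+ 2) D ->
  has_mean P (fun w => frob_norm (delta k.+1 w) ^+ 2) D' ->
  D' <= (1 - 3 / 2 * A * (alpha k * gamma k)) * D +
    alpha k * gamma k * (4 / A * (C1 ^+ 2 * E + C2 ^+ 2 * gamma k ^+ 2)) +
    alpha k ^+ 2 * Mbar.
Proof.
move=> a0 g0 eE hD hD'.
have [a ha] := mean_inner hD; have [M hM MM] := mean_sqr_g k.
have [v [hv vge]] := mean_over_perturbation (mean_over_process ha).
set c := 2 / A * (C1 ^+ 2 * E + C2 ^+ 2 * gamma k ^+ 2).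
have : gamma k * (3 / 4 * A * D - c) <= a.
  apply: le_has_mean (has_meanZ (gamma k)
    (has_meanB (has_meanZ (3 / 4 * A) hD) (has_mean_cst P c))) hv.
  apply: filterS eE => w eE; apply: le_trans (vge w).
  exact: descent_pointwise.
have -> : D' = D - 2 * alpha k * a + alpha k ^+ 2 * M.
  apply: has_mean_unique hD' _.
  apply: has_mean_ext
    (has_meanD (has_meanB hD (has_meanZ _ ha)) (has_meanZ _ hM)) => w.
  by rewrite sqr_deltaS.
move=> /(ler_wpM2l a0) h1; have := ler_wpM2l (sqr_ge0 (alpha k)) MM.
rewrite (_ : 4 / A * _ = 2 * c); last by rewrite /c; ring.
lra.
Qed.

Variable G : R.
Hypothesis y_bounded : forall k,
  {ae P, forall w, frob_norm (consensus_error (y k w)) <= G}.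

(** The bound is a deterministic sequence: starting from a fixed [x_0], the
    consensus error is driven only by the almost surely bounded one of [y_k].
    The contraction factor loses at most half of its distance to 1 to
    Young's inequality. *)
Lemma consensus_bound : exists (q K : R) (E : nat -> R),
  [/\ 0 <= q, q < 1, 0 <= K,
    forall k, E k.+1 = q * E k + K * alpha k ^+ 2 &
    forall k, {ae P, forall w, frob_norm (consensus_error (x k w)) ^+ 2 <= E k}].
Proof.
have [r [r0 r1 rP]] := @mixing_contraction R n d e W n_gt0 graphA.
pose eta := (1 - r) / 2; have eta0 : 0 < eta by rewrite divr_gt0 ?subr_gt0.
pose q := r * (1 + eta); pose K := r * (1 + eta^-1) * G ^+ 2.
have q0 : 0 <= q by rewrite mulr_ge0// addr_ge0// ltW.
have q1 : q < 1 by rewrite /q /eta; nra.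
have K0 : 0 <= K by rewrite mulr_ge0 ?sqr_ge0// mulr_ge0// addr_ge0// invr_ge0 ltW.
pose E := fix E k := if k is l.+1 then q * E l + K * alpha l ^+ 2
  else frob_norm (consensus_error x0) ^+ 2.
exists q, K, E; split => //.
elim=> [|k IH]; first by apply: nearW => w; rewrite (dsgt_x0 algA).
apply: filterS2 IH (y_bounded k) => w Ek yG; rewrite consensus_errorS.
apply: le_trans (rP _ _) _.
  by rewrite row_meanB row_meanZ !row_mean_consensus// scaler0 subr0.
apply: (@le_trans _ _ (r * ((1 + eta) * E k + (1 + eta^-1) * (alpha k ^+ 2 * G ^+ 2)))).
  rewrite ler_wpM2l//; apply: le_trans (sqr_frob_normB_le _ _ eta0) _.
  rewrite lerD// ler_wpM2l ?addr_ge0 ?invr_ge0 ?(ltW eta0)//.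
  rewrite frob_normZ exprMn real_normK ?num_real// ler_wpM2l ?sqr_ge0//.
  by rewrite ler_pXn2r ?nnegrE ?frob_norm_ge0// (le_trans _ yG) ?frob_norm_ge0.
by rewrite le_eqVlt; apply/orP; left; apply/eqP; rewrite /= /q /K; ring.
Qed.

Lemma mean_sqr_rate a0 g0 u1 u2 :
  alpha = step a0 u1 -> gamma = step g0 u2 ->
  0 < a0 -> 0 < g0 -> 1 / 2 < u1 -> 0 < u2 -> u2 <= 1 - u1 ->
  Num.max (2 * u2) (u1 - u2) / A <= a0 * g0 ->
  exists Z, forall k,
    ('E_P[fun w => (frob_norm (delta k w) ^+ 2)%R] <=
      (Z * k.+1%:R `^ (- Num.min (2 * u2) (u1 - u2)))%:E)%E.
Proof.
move=> aE gE a00 g00 u1h u20 u12 big_step.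
have [q [K [E [q0 q1 K0 rec eE]]]] := consensus_bound; rewrite aE in rec.
have u10 : 0 <= u1 by lra.
have [Y Y0 EY] := geometric_rate q0 q1 K0 u10 rec.
have [D hD] := choice mean_sqr_delta_ex.
have [|Z _ DZ] := stochastic_gradient_rate (D := D) (M := Mbar) A_gt0 a00 g00 u1h u20 u12
  (sqr_ge0 C1) (sqr_ge0 C2) Y0 EY _ big_step.
  move=> k; rewrite -aE -gE; apply: mean_sqr_recursion (eE k) (hD k) (hD k.+1).
    by rewrite aE step_ge0 ?ltW.
  by rewrite gE step_ge0 ?ltW.
by exists Z => k; rewrite (has_mean_EFin (hD k)) lee_fin.
Qed.

End Recursion.
End OneStep.

Theorem theorem7 (R : realType) (disp : measure_display)
  (Omega : measurableType disp) (P : probability Omega R)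
  (n d m : nat) (n_gt0 : (0 < n)%N)
  (* problem data *)
  (f : 'I_n -> 'rV[R]_d -> m.-tuple R -> R)
  (SS : set (m.-tuple R)) (muS : probability (m.-tuple R) R)
  (L : m.-tuple R -> R) (xs : 'rV[R]_d)
  (e : rel 'I_n) (W : 'M[R]_n)
  (* randomness *)
  (S : 'I_n -> nat -> {RV P >-> m.-tuple R})
  (phi : 'I_n -> nat -> 'I_d -> {RV P >-> R})
  (zeta : 'I_n -> nat -> {RV P >-> R})
  (* constants and step sizes *)
  (alpha1 alpha2 alpha3 alpha4 lambda alpha0 gamma0 u1 u2 Mbar G : R)
  (* iterates *)
  (x0 : 'M[R]_(n, d)) (x y : nat -> Omega -> 'M[R]_(n, d))
  (K0 K1 K2 : nat) :
  let alpha := step alpha0 u1 in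
  let gamma := step gamma0 u2 in
  let A := lambda * alpha2 in
  let rho := rho_w W in
  let g := grad_estimate S phi zeta f gamma x in
  0 < alpha0 -> 0 < gamma0 ->
  1 / 2 < u1 -> u1 < 1 -> 0 < u2 -> u2 <= 1 - u1 ->
  graph_assumption e W ->
  is_minimizer f SS muS xs ->
  objective_assumption f SS muS xs alpha1 ->
  local_function_assumption f SS muS L ->
  process_assumption S SS muS ->
  noise_assumption zeta alpha4 ->
  perturbation_assumption phi alpha2 alpha3 ->
  independent_sources S phi zeta ->
  strong_convexity f SS muS xs lambda ->
  is_1PDSGT S phi zeta f W alpha gamma x0 x y ->
  (forall k, ('E_P[fun w => (frob_norm (row_mean (g k w)) ^+ 2)%R] <= Mbar%:E)%E) ->
  (forall k, {ae P, forall w, frob_norm (consensus_error (y k w)) <= G}) ->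
  is_smallest (fun k => A * alpha k * gamma k < 1) K0 ->
  is_smallest (fun k => ((1 + rho ^+ 2) / 2) ^+ k <= alpha k ^+ 2) K1 ->
  (maxn K0 K1 <= K2)%N ->
  Num.max (2 * u2) (u1 - u2) / A <= alpha0 * gamma0 ->
  exists Upsilon : R, forall k : nat, (K2 <= k)%N ->
    ('E_P[fun w => (frob_norm (row_mean (x k w) - xs) ^+ 2)%R]
       <= (Upsilon * k.+1%:R `^ (- Num.min (2 * u2) (u1 - u2)))%:E)%E.
Proof.
move=> alpha gamma A rho g a00 g00 u1h u11 u20 u12 graphA _ objA locA procA _ pertA
  indepA scA algA g_bounded y_bounded _ _ _ big_step.
have [Z hZ] := mean_sqr_rate objA locA procA pertA indepA algA n_gt0 graphA scA
  g_bounded y_bounded (erefl : alpha = step alpha0 u1) (erefl : gamma = step gamma0 u2)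
  a00 g00 u1h u20 u12 big_step.
by exists Z => k _; exact: hZ.
Qed.
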